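(* Let $n\ge 3$ and consider a regular $n$-gon in the hyperbolic plane of in-radius $r$ (the distance from its center to each of its sides), regarded as a lamina of uniform density $1$. Then its mass is half the product of its perimeter with $\sinh r$; that is, if $a$ is the hyperbolic length of a side, its mass is $\frac{1}{2}\,na\sinh r$.
   Context: The hyperbolic plane has curvature $-1$, with distance $d$ and area element $dA$. A region is a compact subset of the hyperbolic plane of finite positive measure. A lamina $\mathcal{L}=(L,\lambda)$ consists of a region $L$ and a continuous non-negative function $\lambda$ (the density) on $L$ with $\iint_L\lambda(X)\,dA>0$; it is uniform if $\lambda$ is constant. For a directed straight line (geodesic) $m$, let $\sigma_m(X)=1,-1,0$ according as $X$ is in the left half-plane of $m$, in the right half-plane of $m$, or on $m$. The moment of $\mathcal{L}$ with respect to $m$ is $M_m(\mathcal{L})=\iint_L\sigma_m(X)\lambda(X)\sinh[d(X,m)]\,dA$, and $\mathcal{L}$ is balanced with respect to $m$ if $M_m(\mathcal{L})=0$. The straight lines with respect to which $\mathcal{L}$ is balanced are concurrent, and their common point is the location $C(\mathcal{L})$ of the center of mass of $\mathcal{L}$. The mass of $\mathcal{L}$ is $c(\mathcal{L})=\iint_L\lambda(X)\cosh[d(X,C(\mathcal{L}))]\,dA$. A polygonal lamina has as its region the closed region bounded by the polygon. *)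

(* Defs.v *)
From mathcomp Require Import all_boot all_order all_algebra.
From mathcomp Require Import all_classical all_reals all_analysis.
From mathcomp Require Import ring.

Set Implicit Arguments.
Unset Strict Implicit.
Unset Printing Implicit Defensive.

Import Order.TTheory GRing.Theory Num.Theory.
Import numFieldNormedType.Exports.

Local Open Scope classical_set_scope.
Local Open Scope ring_scope.

(** The hyperbolic plane of curvature -1 in the Beltrami-Klein (projective)
    model: the open unit disk of R x R, whose straight lines are the chords of
    the disk.  The Klein disk carries the subspace topology of R x R, so the
    compactness and continuity below are the hyperbolic ones. *)

Section HyperbolicPlane.
Variable R : realType.
Implicit Types X Y A B C : R * R.

Definition cosh (t : R) : R := (expR t + expR (- t)) / 2.
Definition sinh (t : R) : R := (expR t - expR (- t)) / 2.
Definition arcosh (t : R) : R := ln (t + Num.sqrt (t ^+ 2 - 1)).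

Definition dot X Y : R := X.1 * Y.1 + X.2 * Y.2.

Definition hplane : set (R * R) := [set X | dot X X < 1].

Definition dist X Y : R :=
  arcosh ((1 - dot X Y) / (Num.sqrt (1 - dot X X) * Num.sqrt (1 - dot Y Y))).

Definition dist_to X (S : set (R * R)) : R := inf [set dist X Y | Y in S].

(** Riemannian metric of the model at [X], on tangent vectors [u], [v]. *)
Definition metric X (u v : R * R) : R :=
  dot u v / (1 - dot X X) + dot X u * dot X v / (1 - dot X X) ^+ 2.

(** The angle [A V B].  Geodesics are chords, so [A - V] and [B - V] are tangent
    at [V] to the geodesics towards [A] and [B]; the model is not conformal, so
    the angle between them has to be measured with [metric]. *)
Definition angle A V B : R :=
  let u := A - V in let v := B - V in
  acos (metric V u v / Num.sqrt (metric V u u * metric V v v)).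

(** [dA = area_density X dx dy] with [area_density] the square root of the Gram
    determinant of the metric, see [area_densityE] for its closed form. *)
Definition area_density X : R :=
  let e1 := (1, 0) in let e2 := (0, 1) in
  Num.sqrt (metric X e1 e1 * metric X e2 e2 - metric X e1 e2 ^+ 2).

Definition hintegral (S : set (R * R)) (f : R * R -> R) : \bar R :=
  (\int[(@lebesgue_measure R \x @lebesgue_measure R)%E]_(X in S)
     (f X * area_density X)%:E)%E.

Definition area (S : set (R * R)) : \bar R := hintegral S (cst 1).

(** Positive, negative or zero according as [X] is to the left of, to the right
    of, or on the straight line directed from [A] to [B]. *)
Definition orient A B X : R :=
  (B.1 - A.1) * (X.2 - A.2) - (B.2 - A.2) * (X.1 - A.1).

Record dline := DLine {
  dl_src : R * R;
  dl_tgt : R * R;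
  dl_src_in : hplane dl_src;
  dl_tgt_in : hplane dl_tgt;
  dl_neq : dl_src != dl_tgt }.

Definition line_set (m : dline) : set (R * R) :=
  [set X | hplane X /\ orient (dl_src m) (dl_tgt m) X = 0].

Definition side_sign (m : dline) X : R :=
  Num.sg (orient (dl_src m) (dl_tgt m) X).

Definition segment A B : set (R * R) :=
  [set A + t *: (B - A) | t in [set t : R | 0 <= t <= 1]].

(** The values of [density] outside [region] are irrelevant. *)
Record lamina := Lamina {
  region : set (R * R);
  density : R * R -> R;
  region_hplane : region `<=` hplane;
  region_compact : compact region;
  region_area_gt0 : (0 < area region)%E;
  region_area_fin : (area region < +oo)%E;
  density_continuous : {within region, continuous density};
  density_ge0 : forall X, region X -> 0 <= density X;
  density_gt0 : (0 < hintegral region density)%E }.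

Definition moment (L : lamina) (m : dline) : \bar R :=
  hintegral (region L)
    (fun X => side_sign m X * density L X * sinh (dist_to X (line_set m))).

Definition balanced (L : lamina) (m : dline) : Prop := moment L m = 0%E.

(** The common point of the lines with respect to which [L] is balanced. *)
Definition center_of_mass (L : lamina) : R * R :=
  get [set C | hplane C /\ forall m, balanced L m -> line_set m C].

Definition mass (L : lamina) : \bar R :=
  hintegral (region L)
    (fun X => density L X * cosh (dist X (center_of_mass L))).

(** A polygon is the cyclic sequence of its vertices; side [i] joins vertex [i]
    to its cyclic successor [ordS i]. *)
Section Polygon.
Variables (n : nat) (P : 'I_n -> R * R).

Definition side (i : 'I_n) : set (R * R) := segment (P i) (P (ordS i)).

Definition side_length (i : 'I_n) : R := dist (P i) (P (ordS i)).

Definition perimeter : R := \sum_(i < n) side_length i.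

Definition polygon_boundary : set (R * R) := \bigcup_i side i.

(** The polygon together with the points that it separates from infinity. *)
Definition polygon_region : set (R * R) :=
  polygon_boundary `|`
  [set X | [/\ hplane X, ~ polygon_boundary X &
     exists M : R, forall Y,
       connected_component (hplane `\` polygon_boundary) X Y -> dist X Y <= M]].

(** All the vertices other than the ends of a side lie strictly on one and the
    same side of the line through it; for [2 < n] this forces the vertices to be
    distinct and excludes star polygons.  Either orientation is allowed. *)
Definition convex_polygon : Prop :=
  (forall i, hplane (P i)) /\
  forall i j k : 'I_n,
    j != i -> j != ordS i -> k != i -> k != ordS i ->
    0 < orient (P i) (P (ordS i)) (P j) * orient (P i) (P (ordS i)) (P k).

Definition regular_polygon : Prop :=
  [/\ convex_polygon,
      forall i j, side_length i = side_length j &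
      forall i j, angle (P (ord_pred i)) (P i) (P (ordS i)) =
                  angle (P (ord_pred j)) (P j) (P (ordS j))].

Definition polygon_center (O : R * R) : Prop :=
  hplane O /\ forall i j, dist O (P i) = dist O (P j).

Definition polygon_inradius (r : R) : Prop :=
  exists2 O, polygon_center O & forall i, dist_to O (side i) = r.

End Polygon.

Lemma area_densityE X : hplane X ->
  area_density X = (Num.sqrt (1 - dot X X) ^+ 3)^-1.
Proof.
rewrite /hplane /= -subr_gt0 => w0.
have w1 : 1 - dot X X != 0 by rewrite gt_eqF.
rewrite /area_density.
set g := (X in Num.sqrt X).
have -> : g = ((Num.sqrt (1 - dot X X) ^+ 3)^-1) ^+ 2.
  rewrite exprVn -exprM mulnC exprM sqr_sqrtr ?ltW// /g /metric.
  by move: w1; rewrite /dot /= => w1; field.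
by rewrite sqrtr_sqr ger0_norm// invr_ge0 exprn_ge0// sqrtr_ge0.
Qed.

End HyperbolicPlane.

(* Main.v *)
(** In the Klein model the signed [sinh]-distance to a line, multiplied by the
    area density, is an affine function times [w = (1 - |X|^2)^-2].  Hence the
    moments see only the vector [V = (int w, int x w, int y w)], i.e. the
    integral over the polygon of the Lorentz vectors above its points; the
    center of mass is the Klein point below [V].  With
    [f = 1 / (2 (1 - |X|^2))] one has [x w = d_x f], [y w = d_y f] and
    [w = d_x (x f) + d_y (y f)], so Green's formula (Fubini on vertical and
    horizontal slices) makes [V] a sum over the sides of [int f] along the side
    times the normal vector of the side, which is half the length of the side
    times its unit normal.  For equal sides and equal circumradii this sum is
    proportional to the vector above the center [O]; hence [O] is the center
    of mass, and the mass is the Lorentz product of [V] with the unit vector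
    above [O], in which each side contributes half its length times [sinh] of
    its distance to [O]. *)

Require Import Defs.
From mathcomp Require Import all_boot all_order all_algebra.
From mathcomp Require Import all_classical all_reals all_analysis.
From mathcomp Require Import ring lra.
From mathcomp Require Import measurable_realfun.

Set Implicit Arguments.
Unset Strict Implicit.
Unset Printing Implicit Defensive.

Import Order.TTheory GRing.Theory Num.Theory.
Import numFieldNormedType.Exports.

Local Open Scope classical_set_scope.
Local Open Scope ring_scope.

(** * Distances in the Klein model *)

Section KleinDistance.
Variable R : realType.
Implicit Types (t : R) (A B X Y : R * R) (S : set (R * R)).

(** The polygon is given by sign conditions on its vertices and its region by components of a
    complement, while slicing needs intervals bounded by exactly one lower and one upper side. The
    bridge is [half_planes], the intersection of the closed half-planes of the sides, with a sign
    [e] absorbing the orientation. Its geometry rests mostly on one fact, [half_planes_separation]: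
    no point of the intersection can be strictly separated from all the vertices. This yields the
    empty slices, the inclusion in the disk and the bounds on the integrands. Two points about the
    center [O] are not part of the hypotheses. That [O] lies on the inner side of every side is read
    off the integral, since [O] is the mean of the region for a positive weight. That the in-radius,
    a distance to a segment, equals the distance to the whole line follows because [O] is
    equidistant from both ends, which puts the foot of the perpendicular on the segment. *)

Lemma expR_arcosh t : 1 <= t -> expR (arcosh t) = t + Num.sqrt (t ^+ 2 - 1).
Proof.
by move=> t1; rewrite /arcosh lnK// posrE; have := sqrtr_ge0 (t ^+ 2 - 1); lra.
Qed.

Lemma expR_arcoshN t :
  1 <= t -> expR (- arcosh t) = t - Num.sqrt (t ^+ 2 - 1).
Proof.
move=> t1; rewrite expRN expR_arcosh//.
have d0 : 0 <= t ^+ 2 - 1 by nra.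
set s := Num.sqrt _.
have s0 : 0 <= s by exact: sqrtr_ge0.
have s2 : s ^+ 2 = t ^+ 2 - 1 by rewrite sqr_sqrtr.
have ts0 : t + s != 0 by rewrite gt_eqF//; lra.
apply: (mulfI ts0); rewrite mulfV// mulrC -subr_sqr s2; ring.
Qed.

Lemma cosh_arcosh t : 1 <= t -> cosh (arcosh t) = t.
Proof. by move=> t1; rewrite /cosh expR_arcosh// expR_arcoshN//; field. Qed.

Lemma sinh_arcosh t : 1 <= t -> sinh (arcosh t) = Num.sqrt (t ^+ 2 - 1).
Proof. by move=> t1; rewrite /sinh expR_arcosh// expR_arcoshN//; field. Qed.

Lemma arcosh_le t1 t2 : 1 <= t1 -> t1 <= t2 -> arcosh t1 <= arcosh t2.
Proof.
move=> h1 h12; rewrite /arcosh.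
have e : Num.sqrt (t1 ^+ 2 - 1) <= Num.sqrt (t2 ^+ 2 - 1).
  by apply: ler_wsqrtr; nra.
have := sqrtr_ge0 (t1 ^+ 2 - 1) => s0.
by rewrite ler_ln ?posrE; lra.
Qed.

(** Minus the Gram determinant of the Lorentz vectors [(1, A)] and [(1, B)]; that it is nonnegative
    is the reversed Cauchy-Schwarz inequality. *)
Definition klein_gram A B : R :=
  (1 - dot A B) ^+ 2 - (1 - dot A A) * (1 - dot B B).

Definition dist_ratio X Y : R :=
  (1 - dot X Y) / (Num.sqrt (1 - dot X X) * Num.sqrt (1 - dot Y Y)).

Lemma hplane_gt0 X : hplane X -> 0 < 1 - dot X X.
Proof. by rewrite subr_gt0. Qed.

Lemma hplane_sqrt_gt0 X : hplane X -> 0 < Num.sqrt (1 - dot X X).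
Proof. by move=> hX; rewrite sqrtr_gt0 hplane_gt0. Qed.

Lemma hplane_dot_gt0 X Y : hplane X -> dot Y Y <= 1 -> 0 < 1 - dot X Y.
Proof.
move: X Y => [x1 x2] [y1 y2]; rewrite /hplane /dot /= => hX hY.
have := sqr_ge0 (x1 - y1); have := sqr_ge0 (x2 - y2); lra.
Qed.

Lemma klein_gramE A B : klein_gram A B =
  (1 - dot A A) * dot (B - A) (B - A) + dot A (B - A) ^+ 2.
Proof.
by move: A B => [a1 a2] [b1 b2]; rewrite /klein_gram /dot /=; ring.
Qed.

Lemma dot_self_ge0 X : 0 <= dot X X.
Proof. by rewrite /dot -!expr2 addr_ge0 ?sqr_ge0. Qed.

Lemma dot_self_gt0 A B : A != B -> 0 < dot (B - A) (B - A).
Proof.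
move: A B => [a1 a2] [b1 b2] AB; rewrite lt_def dot_self_ge0 andbT.
apply: contra AB; rewrite /dot /= -!expr2 paddr_eq0 ?sqr_ge0//.
by rewrite !sqrf_eq0 !subr_eq0 => /andP[/eqP -> /eqP ->].
Qed.

Lemma klein_gram_ge0 A B : hplane A -> 0 <= klein_gram A B.
Proof.
move=> hA; rewrite klein_gramE addr_ge0 ?sqr_ge0// mulr_ge0 ?dot_self_ge0//.
exact/ltW/hplane_gt0.
Qed.

Lemma klein_gram_gt0 A B : hplane A -> A != B -> 0 < klein_gram A B.
Proof.
move=> hA AB; rewrite klein_gramE ltr_wpDr ?sqr_ge0// mulr_gt0 ?dot_self_gt0//.
exact: hplane_gt0.
Qed.

Lemma dist_ratio_gt0 X Y : hplane X -> hplane Y -> 0 < dist_ratio X Y.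
Proof.
move=> hX hY; rewrite divr_gt0 ?mulr_gt0 ?hplane_sqrt_gt0//.
by rewrite hplane_dot_gt0// ltW.
Qed.

Lemma dist_ratio_sqr X Y : hplane X -> hplane Y ->
  dist_ratio X Y ^+ 2 =
  1 + klein_gram X Y / ((1 - dot X X) * (1 - dot Y Y)).
Proof.
move=> hX hY; have x0 := hplane_gt0 hX; have y0 := hplane_gt0 hY.
rewrite exprMn exprVn exprMn !sqr_sqrtr ?ltW// /klein_gram.
by field; rewrite !gt_eqF.
Qed.

Lemma dist_ratio_ge1 X Y : hplane X -> hplane Y -> 1 <= dist_ratio X Y.
Proof.
move=> hX hY; rewrite -(@ler_pXn2r _ 2)// ?nnegrE ?ler01//; last first.
  exact/ltW/dist_ratio_gt0.
rewrite expr1n dist_ratio_sqr// lerDl divr_ge0 ?klein_gram_ge0//.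
by rewrite mulr_ge0// ltW// hplane_gt0.
Qed.

Lemma cosh_dist X Y : hplane X -> hplane Y -> cosh (dist X Y) = dist_ratio X Y.
Proof. by move=> hX hY; rewrite cosh_arcosh// dist_ratio_ge1. Qed.

Lemma sinh_dist X Y : hplane X -> hplane Y -> sinh (dist X Y) =
  Num.sqrt (klein_gram X Y) /
  (Num.sqrt (1 - dot X X) * Num.sqrt (1 - dot Y Y)).
Proof.
move=> hX hY; rewrite sinh_arcosh ?dist_ratio_ge1// -/(dist_ratio X Y).
rewrite dist_ratio_sqr// addrAC subrr add0r sqrtrM ?klein_gram_ge0//.
by rewrite sqrtrV ?mulr_ge0 ?ltW ?hplane_gt0// sqrtrM// ltW// hplane_gt0.
Qed.

Lemma dist_toE X S Y : S `<=` (@hplane R) -> hplane X -> S Y ->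
  (forall Z, S Z -> dist_ratio X Y <= dist_ratio X Z) ->
  dist_to X S = dist X Y.
Proof.
move=> SH hX SY minY; apply/eqP; rewrite eq_le; apply/andP; split.
  apply: ge_inf; last by exists Y.
  exists (dist X Y) => _ [Z SZ <-].
  by apply: arcosh_le; rewrite ?dist_ratio_ge1 ?minY//; exact: SH.
apply: lb_le_inf; first by exists (dist X Y), Y.
move=> _ [Z SZ <-].
by apply: arcosh_le; rewrite ?dist_ratio_ge1 ?minY//; exact: SH.
Qed.

(** Up to sign, [orient A B X ^+ 2] is the Gram determinant of the Lorentz
    vectors above [A], [B] and [X]. *)
Lemma orient_sqr A B X :
  orient A B X ^+ 2 + klein_gram A B * (1 - dot X X) =
  2 * (1 - dot A B) * (1 - dot X A) * (1 - dot X B)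
  - (1 - dot B B) * (1 - dot X A) ^+ 2 - (1 - dot A A) * (1 - dot X B) ^+ 2.
Proof.
move: A B X => [a1 a2] [b1 b2] [x1 x2].
by rewrite /klein_gram /orient /dot /=; ring.
Qed.

(** Vanishes at the foot of the perpendicular from [X] to the line [A B]. *)
Definition foot_eq A B X t : R :=
  (1 - t) * ((1 - dot X A) * (1 - dot A B) - (1 - dot A A) * (1 - dot X B))
  + t * ((1 - dot X A) * (1 - dot B B) - (1 - dot X B) * (1 - dot A B)).

(** [foot_eq A B X t] is the Lorentz pairing of the bivectors [X ^ Y] and [A ^ B]. Projecting [X] to
    the plane spanned by [A] and [B] makes its square a product of two Gram determinants. On the
    line, the squared distance ratio is therefore a constant plus a nonnegative multiple of
    [foot_eq ^+ 2 / (1 - dot Y Y)], minimal at a root. *)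
Lemma foot_eq_sqr A B X t :
  let Y := A + t *: (B - A) in
  foot_eq A B X t ^+ 2 = (1 - dot X Y) ^+ 2 * klein_gram A B
  - (1 - dot Y Y) * (orient A B X ^+ 2 + klein_gram A B * (1 - dot X X)).
Proof.
move: A B X => [a1 a2] [b1 b2] [x1 x2] /=; rewrite orient_sqr.
by rewrite /foot_eq /klein_gram /dot /= /GRing.scale /=; ring.
Qed.

(** Shows that [foot_eq], affine in [t], is not constant and so has a root. *)
Lemma foot_eq_slope_sqr A B X :
  (foot_eq A B X 1 - foot_eq A B X 0) ^+ 2 =
  (dot X A - dot X B) ^+ 2 * klein_gram A B +
  dot (B - A) (B - A) * (orient A B X ^+ 2 + klein_gram A B * (1 - dot X X)).
Proof.
move: A B X => [a1 a2] [b1 b2] [x1 x2].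
by rewrite orient_sqr /foot_eq /klein_gram /dot /=; ring.
Qed.

(** Stated for any part [S] of the line that contains the foot, so as to serve both the full lines
    of the moments and the segments of the in-radius. *)
Lemma sinh_dist_to A B X S t : hplane A -> A != B -> hplane X ->
  S `<=` (@hplane R) -> (forall Y, S Y -> exists s, Y = A + s *: (B - A)) ->
  S (A + t *: (B - A)) -> foot_eq A B X t = 0 ->
  sinh (dist_to X S) =
  `|orient A B X| / (Num.sqrt (klein_gram A B) * Num.sqrt (1 - dot X X)).
Proof.
move=> hA AB hX SH Sline SY foot; set Y := A + t *: (B - A) in SY.
have D0 := klein_gram_gt0 hA AB; have x0 := hplane_gt0 hX.
have hY := SH _ SY; have y0 := hplane_gt0 hY.
have ratioE Z : hplane Z -> dist_ratio X Z ^+ 2 =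
    (1 - dot X Z) ^+ 2 / ((1 - dot X X) * (1 - dot Z Z)).
  move=> hZ; have z0 := hplane_gt0 hZ.
  by rewrite exprMn exprVn exprMn !sqr_sqrtr ?ltW.
have YE := foot_eq_sqr A B X t; rewrite /= -/Y foot expr0n/= in YE.
have Y2 : dist_ratio X Y ^+ 2 =
    1 + orient A B X ^+ 2 / (klein_gram A B * (1 - dot X X)).
  rewrite ratioE//; set o := orient A B X in YE *.
  set k := klein_gram A B in YE D0 *.
  set x := 1 - dot X X in YE x0 *; set y := 1 - dot Y Y in YE y0 *.
  set z := 1 - dot X Y in YE *.
  have -> : z ^+ 2 = y * (o ^+ 2 + k * x) / k.
    by apply: (canRL (mulfK _)); rewrite ?gt_eqF//; lra.
  by field; rewrite !gt_eqF.
rewrite (dist_toE SH hX SY).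
  rewrite sinh_dist// -[LHS]ger0_norm ?divr_ge0 ?mulr_ge0 ?sqrtr_ge0//.
  rewrite -sinh_dist// sinh_arcosh ?dist_ratio_ge1// -/(dist_ratio _ _) Y2.
  rewrite addrAC subrr add0r ger0_norm ?sqrtr_ge0//.
  by rewrite sqrtrM ?sqr_ge0// sqrtr_sqr sqrtrV ?sqrtrM ?mulr_ge0// ltW.
move=> Z SZ; have hZ := SH _ SZ; have [s Zs] := Sline _ SZ.
have z0 := hplane_gt0 hZ.
rewrite -(@ler_pXn2r _ 2)// ?nnegrE; try exact/ltW/dist_ratio_gt0.
rewrite Y2 ratioE//.
have := foot_eq_sqr A B X s; rewrite /= -Zs => ZE.
have := sqr_ge0 (foot_eq A B X s); rewrite ZE.
set o := orient A B X; set k := klein_gram A B in D0 *.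
set x := 1 - dot X X in x0 *; set z := 1 - dot Z Z in z0 *.
set w := 1 - dot X Z => h.
have -> : 1 + o ^+ 2 / (k * x) = (o ^+ 2 + k * x) / (k * x).
  by field; rewrite !gt_eqF.
rewrite ler_pdivrMr ?mulr_gt0// mulrAC ler_pdivlMr ?mulr_gt0//.
rewrite -subr_ge0.
have -> : w ^+ 2 * (k * x) - (o ^+ 2 + k * x) * (x * z) =
  x * (w ^+ 2 * k - z * (o ^+ 2 + k * x)) by ring.
by rewrite mulr_ge0// ltW.
Qed.

Lemma orient_line A B t : orient A B (A + t *: (B - A)) = 0.
Proof.
by move: A B => [a1 a2] [b1 b2]; rewrite /orient /= /GRing.scale /=; ring.
Qed.

Lemma orient_eq0 A B Y : A != B -> orient A B Y = 0 ->
  exists t, Y = A + t *: (B - A).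
Proof.
move=> /dot_self_gt0; move: A B Y => [a1 a2] [b1 b2] [y1 y2].
rewrite /orient /dot /= => v0 o.
exists (((b1 - a1) * (y1 - a1) + (b2 - a2) * (y2 - a2)) /
  ((b1 - a1) * (b1 - a1) + (b2 - a2) * (b2 - a2))).
move: v0 o; set u := b1 - a1; set v := b2 - a2 => v0 o.
have v1 : u * u + v * v != 0 by rewrite gt_eqF.
have uE : b1 - a1 = u by []. have vE : b2 - a2 = v by [].
have o' : u * (y2 - a2) - v * (y1 - a1) = 0 by [].
congr pair; rewrite /= /GRing.scale /= ?uE ?vE; apply/eqP; rewrite -subr_eq0.
  have -> : y1 - (a1 + (u * (y1 - a1) + v * (y2 - a2)) / (u * u + v * v) * u) =
    - v * (u * (y2 - a2) - v * (y1 - a1)) / (u * u + v * v) by field.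
  by rewrite o' mulr0 mul0r.
have -> : y2 - (a2 + (u * (y1 - a1) + v * (y2 - a2)) / (u * u + v * v) * v) =
  u * (u * (y2 - a2) - v * (y1 - a1)) / (u * u + v * v) by field.
by rewrite o' mulr0 mul0r.
Qed.

Lemma sinh_dist_to_line (m : dline R) X : hplane X ->
  sinh (dist_to X (line_set m)) = `|orient (dl_src m) (dl_tgt m) X| /
    (Num.sqrt (klein_gram (dl_src m) (dl_tgt m)) * Num.sqrt (1 - dot X X)).
Proof.
case: m => A B hA hB AB hX /=; set S := line_set _.
have D0 := klein_gram_gt0 hA AB; have x0 := hplane_gt0 hX.
pose c0 := foot_eq A B X 0; pose c1 := foot_eq A B X 1.
have footE t : foot_eq A B X t = (1 - t) * c0 + t * c1.
  by rewrite /c0 /c1 /foot_eq; ring.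
have E0 : c1 - c0 != 0.
  rewrite -sqrf_eq0 gt_eqF//.
  rewrite foot_eq_slope_sqr.
  apply: ltr_wpDl; first by rewrite mulr_ge0 ?sqr_ge0 ?ltW.
  by rewrite mulr_gt0 ?dot_self_gt0// ltr_wpDl ?sqr_ge0 ?mulr_gt0.
pose t := c0 / (c0 - c1).
have foot : foot_eq A B X t = 0.
  by rewrite footE /t; field; rewrite -oppr_eq0 opprB.
apply: (@sinh_dist_to A B X S t) => //.
- by move=> Y [].
- by move=> Y [_]; exact: orient_eq0.
split; last exact: orient_line.
(* If the root were on or outside the unit circle, the signs in [foot_eq_sqr] would force both
   [1 - dot X Y] and [1 - dot Y Y] to vanish, and [hplane_dot_gt0] excludes this. *)
have := foot_eq_sqr A B X t; rewrite foot expr0n/=.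
set Y := A + _ => YE; rewrite /hplane /= ltNge; apply/negP => Y1.
have c : 0 < orient A B X ^+ 2 + klein_gram A B * (1 - dot X X).
  by rewrite ltr_wpDl ?sqr_ge0 ?mulr_gt0.
have dY : (dot Y Y - 1) * (orient A B X ^+ 2 + klein_gram A B * (1 - dot X X))
  = - ((1 - dot X Y) ^+ 2 * klein_gram A B) by rewrite -[RHS]opprK; lra.
have : (1 - dot X Y) ^+ 2 * klein_gram A B <= 0.
  by rewrite -oppr_ge0 -dY mulr_ge0 ?subr_ge0// ltW.
rewrite pmulr_lle0// => /(conj (sqr_ge0 (1 - dot X Y)))/andP/le_anti/esym/eqP.
rewrite sqrf_eq0 => /eqP XY; move: dY; rewrite XY expr0n/= mul0r oppr0 => /eqP.
rewrite mulf_eq0 (gt_eqF c) orbF subr_eq0 => /eqP YY.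
have Y1' : dot Y Y <= 1 by rewrite YY.
by have := hplane_dot_gt0 hX Y1'; rewrite XY ltxx.
Qed.

Lemma hplane_segment A B t : hplane A -> hplane B -> 0 <= t <= 1 ->
  hplane (A + t *: (B - A)).
Proof.
move: A B => [a1 a2] [b1 b2]; rewrite /hplane /dot /= /GRing.scale /=.
move=> hA hB /andP[t0 t1].
have -> : (a1 + t * (b1 - a1)) * (a1 + t * (b1 - a1)) +
          (a2 + t * (b2 - a2)) * (a2 + t * (b2 - a2)) =
   (1 - t) * (a1 * a1 + a2 * a2) + t * (b1 * b1 + b2 * b2)
   - t * (1 - t) * ((b1 - a1) ^+ 2 + (b2 - a2) ^+ 2) by ring.
have : 0 <= t * (1 - t) * ((b1 - a1) ^+ 2 + (b2 - a2) ^+ 2).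
  by apply: mulr_ge0; [rewrite mulr_ge0 ?subr_ge0 | rewrite addr_ge0 ?sqr_ge0].
move: hA hB; set a := a1 * _ + _; set b := b1 * _ + _ => hA hB.
have [->|t00] := eqVneq t 0; first lra.
have tgt : 0 < t by rewrite lt_def t00.
nra.
Qed.

(** By symmetry the foot of the perpendicular is the midpoint of the segment. *)
Lemma sinh_dist_to_isosceles A B X : hplane A -> hplane B -> A != B ->
  hplane X -> dist X A = dist X B ->
  sinh (dist_to X (segment A B)) =
  `|orient A B X| / (Num.sqrt (klein_gram A B) * Num.sqrt (1 - dot X X)).
Proof.
move=> hA hB AB hX XAB.
have : dist_ratio X A = dist_ratio X B by rewrite -!cosh_dist// XAB.
have a0 := hplane_sqrt_gt0 hA; have b0 := hplane_sqrt_gt0 hB.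
have x0 := hplane_sqrt_gt0 hX.
have Ea : 1 - dot A A = Num.sqrt (1 - dot A A) ^+ 2.
  by rewrite sqr_sqrtr// ltW// hplane_gt0.
have Eb : 1 - dot B B = Num.sqrt (1 - dot B B) ^+ 2.
  by rewrite sqr_sqrtr// ltW// hplane_gt0.
move: a0 b0 Ea Eb; rewrite /dist_ratio.
set a := Num.sqrt (1 - dot A A); set b := Num.sqrt (1 - dot B B).
move=> a0 b0 Ea Eb; set x := Num.sqrt _ in x0 * => XE.
have ab0 : a + b != 0 by rewrite gt_eqF// addr_gt0.
have XA : (1 - dot X A) = (1 - dot X B) / b * a.
  have : (1 - dot X A) / (x * a) * (x * a) = (1 - dot X B) / (x * b) * (x * a).
    by rewrite XE.
  rewrite divfK ?mulf_neq0 ?gt_eqF// => ->.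
  by field; rewrite !gt_eqF.
(* The midpoint lies below the sum of the unit Lorentz vectors [(1, A) / a] and [(1, B) / b], whence
   the affine parameter [a / (a + b)]. *)
have t01 : 0 <= a / (a + b) <= 1.
  have ab : 0 < a + b by rewrite addr_gt0.
  by rewrite ler_pdivlMr// mul0r ler_pdivrMr// mul1r lerDl !ltW.
apply: (@sinh_dist_to A B X _ (a / (a + b))) => //.
- by move=> _ [t t1 <-]; exact: hplane_segment.
- by move=> _ [t _ <-]; exists t.
- by exists (a / (a + b)).
rewrite /foot_eq Ea Eb XA; field.
by rewrite ab0 !gt_eqF.
Qed.

End KleinDistance.

(** * Convex polygons *)

Section CyclicOrdinals.
Variable n : nat.

Lemma ordS_ind (Q : 'I_n -> Prop) (i0 : 'I_n) :
  Q i0 -> (forall i, Q i -> Q (ordS i)) -> forall i, Q i.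
Proof.
move=> Q0 QS i.
have n0 : (0 < n)%N := leq_ltn_trans (leq0n i0) (ltn_ord i0).
have Qiter m : Q (iter m (@ordS n) i0) by elim: m => //= m; exact: QS.
have iterE m : val (iter m (@ordS n) i0) = ((i0 + m) %% n)%N.
  elim: m => [|m IH]; first by rewrite addn0 modn_small.
  by rewrite iterS /= IH -addn1 modnDml addn1 addnS.
have -> : i = iter (n - i0 + i) (@ordS n) i0.
  apply: val_inj; rewrite iterE addnA subnKC 1?ltnW//.
  by rewrite modnDl modn_small.
exact: Qiter.
Qed.

Hypothesis n3 : (3 <= n)%N.

Lemma ordS_neq (i : 'I_n) : ordS i != i.
Proof.
apply/eqP => /(congr1 val) /=; move: (nat_of_ord i) (ltn_ord i) => m.
rewrite leq_eqVlt => /predU1P[e|lt].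
  by rewrite e modnn => m0; move: n3; rewrite -e -m0.
by rewrite modn_small// => /esym/n_Sn.
Qed.

Lemma ordSS_neq (i : 'I_n) : ordS (ordS i) != i.
Proof.
apply/eqP => /(congr1 val) /=; move: (nat_of_ord i) (ltn_ord i) => m.
rewrite leq_eqVlt => /predU1P[e|lt].
  by rewrite e modnn modn_small ?(ltnW n3)// => m1; move: n3; rewrite -e -m1.
rewrite (modn_small lt); move: lt; rewrite leq_eqVlt => /predU1P[e|lt].
  by rewrite e modnn => m0; move: n3; rewrite -e -m0.
by rewrite modn_small// => h; have := leqnSn m.+1; rewrite h ltnn.
Qed.

Lemma ordS_inj : injective (@ordS n).
Proof. exact: can_inj (@ordSK n). Qed.

End CyclicOrdinals.

Section ConvexPolygon.
Variables (R : realType) (n : nat).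
Hypothesis n3 : (3 <= n)%N.
Variable P : 'I_n -> R * R.
Implicit Types (X Y Z A B C D : R * R) (i j k : 'I_n) (x y t : R).

Lemma orient_cycle A B C : orient A B C = orient B C A.
Proof. by move: A B C => [a1 a2] [b1 b2] [c1 c2]; rewrite /orient /=; ring. Qed.

Lemma orient_self A B : orient A B A = 0.
Proof. by rewrite /orient !subrr !mulr0 subrr. Qed.

Lemma orient_segment A B C t X :
  orient A B (C + t *: (X - C)) = (1 - t) * orient A B C + t * orient A B X.
Proof.
move: A B C X => [a1 a2] [b1 b2] [c1 c2] [x1 x2].
by rewrite /orient /= /GRing.scale /=; ring.
Qed.

(** Convexity at the side from vertex [i + 1] to [i + 2] compares the vertices [i] and [i + 3], so
    two successive triples of vertices turn the same way. Going round the cycle gives the common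
    sign [e]. *)
Lemma convex_polygon_oriented : convex_polygon P ->
  exists2 e : R, e = 1 \/ e = - 1 & forall i k, k != i -> k != ordS i ->
    0 < e * orient (P i) (P (ordS i)) (P k).
Proof.
move=> [_ convP].
pose c i := orient (P i) (P (ordS i)) (P (ordS (ordS i))).
have i0 : 'I_n by case: n n3 => // m _; exact: ord0.
have n1 i := ordS_neq n3 i. have n2 i := ordSS_neq n3 i.
have n1' i : i != ordS i by rewrite eq_sym.
have n2' i : i != ordS (ordS i) by rewrite eq_sym.
have cS i : 0 < c i * c (ordS i).
  have := convP (ordS i) i (ordS (ordS (ordS i))) (n1' _) (n2' _) (n2 _) (n1 _).
  by rewrite -(orient_cycle (P i)).
have c0 i : 0 < c i0 * c i.
  apply: (@ordS_ind n (fun i => 0 < c i0 * c i) i0) => {i} [|i ci].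
    have := cS i0; case: (ltrgt0P (c i0)) => [h _|h _|->]; [nra|nra|].
    by rewrite mul0r ltxx.
  have := cS i; case: (ltrgt0P (c i)) ci => [h|h|->]; [nra|nra|].
  by rewrite mulr0 ltxx.
have cN0 : c i0 != 0 by apply: contraTneq (c0 i0) => ->; rewrite mul0r ltxx.
have e1 : Num.sg (c i0) = 1 \/ Num.sg (c i0) = -1.
  case: (ltrgt0P (c i0)) cN0 => // h _; first by left; rewrite gtr0_sg.
  by right; rewrite ltr0_sg.
exists (Num.sg (c i0)) => // i k ki kSi.
have := convP i (ordS (ordS i)) k (n2 _) (n1 _) ki kSi.
rewrite -/(c i) => ck; have := c0 i.
case: (ltrgt0P (c i0)) cN0 => // h _.
  by rewrite gtr0_sg// mul1r pmulr_rgt0// => ci; rewrite -(pmulr_rgt0 _ ci).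
rewrite ltr0_sg// mulN1r nmulr_rgt0// => ci; rewrite oppr_gt0.
by rewrite -(nmulr_rgt0 _ ci).
Qed.

Variable e : R.
Hypothesis e1 : e = 1 \/ e = - 1.

Let o i X := e * orient (P i) (P (ordS i)) X.

Hypothesis convP : forall i k, k != i -> k != ordS i -> 0 < o i (P k).

Definition half_planes : set (R * R) :=
  [set X | forall i, 0 <= e * orient (P i) (P (ordS i)) X].

Let o_segment i A B t :
  o i (A + t *: (B - A)) = (1 - t) * o i A + t * o i B.
Proof. by rewrite /o orient_segment; ring. Qed.

Let o_src i : o i (P i) = 0.
Proof. by rewrite /o orient_self mulr0. Qed.

Let o_tgt i : o i (P (ordS i)) = 0.
Proof. by rewrite /o 2!orient_cycle orient_self mulr0. Qed.

Lemma convex_vertex_neq i : P i != P (ordS i).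
Proof.
have := convP (ordSS_neq n3 i) (ordS_neq n3 (ordS i)).
rewrite /o; apply: contraTneq => ->.
by rewrite -2!orient_cycle orient_self mulr0 ltxx.
Qed.

Lemma half_planes_vertex k : half_planes (P k).
Proof.
move=> i; have [->|ki] := eqVneq k i; first by rewrite orient_self mulr0.
have [->|kSi] := eqVneq k (ordS i); first by have := o_tgt i; rewrite /o => ->.
exact/ltW/convP.
Qed.

Lemma half_planes_segment A B t : half_planes A -> half_planes B ->
  0 <= t <= 1 -> half_planes (A + t *: (B - A)).
Proof.
move=> hA hB /andP[t0 t1] i; rewrite -/(o i _) o_segment.
by rewrite addr_ge0// mulr_ge0// ?subr_ge0//; [exact: hA|exact: hB].
Qed.

(** The half-planes of the two neighbouring sides cut the line down to the segment: the next side
    gives [t <= 1], the previous one [0 <= t]. *)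
Lemma half_planes_side i Y : half_planes Y ->
  orient (P i) (P (ordS i)) Y = 0 -> side P i Y.
Proof.
move=> KY /(orient_eq0 (convex_vertex_neq i))[t YE]; exists t => //=.
have o1 : 0 <= o (ordS i) Y := KY (ordS i).
have o2 : 0 <= o (ord_pred i) Y := KY (ord_pred i).
have tgt : o (ord_pred i) (P i) = 0.
  by have := o_tgt (ord_pred i); rewrite ord_predK.
have src1 : 0 < o (ordS i) (P i).
  by apply: convP; rewrite eq_sym ?ordS_neq// ordSS_neq.
have tgt1 : 0 < o (ord_pred i) (P (ordS i)).
  apply: convP; last by rewrite ord_predK ordS_neq.
  by rewrite -{1}(ord_predK i) ordSS_neq.
move: o1 o2; rewrite YE !o_segment tgt o_src !mulr0 add0r addr0.
by rewrite pmulr_lge0// pmulr_lge0// subr_ge0 => -> ->.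
Qed.

Lemma collinear_orient A B C Y Z (a b c : R) :
  A = Y + a *: Z -> B = Y + b *: Z -> C = Y + c *: Z -> orient A B C = 0.
Proof.
move=> -> -> ->; move: Y Z => [y1 y2] [z1 z2].
by rewrite /orient /= /GRing.scale /=; ring.
Qed.

(** The "slopes" of the vectors [P i - Y] relative to [D] are cyclically
    monotone, hence constant, which would make the polygon flat. *)
Lemma half_planes_separation D Y :
  (forall i, 0 < dot D (P i - Y)) -> ~ half_planes Y.
Proof.
move=> sP KY; pose d i := dot D (P i - Y).
pose m i := dot (- D.2, D.1) (P i - Y) / d i.
have i0 : 'I_n by case: n n3 => // k _; exact: ord0.
have d0 i : d i != 0 := lt0r_neq0 (sP i).
have D0 : 0 < dot D D.
  rewrite lt_def dot_self_ge0 andbT; apply: contraTneq (sP i0).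
  move/eqP; rewrite /dot -!expr2 paddr_eq0 ?sqr_ge0// !sqrf_eq0.
  by case/andP => /eqP -> /eqP ->; rewrite !mul0r addr0 ltxx.
have oE i : o i Y * dot D D = d i * d (ordS i) * (e * m (ordS i) - e * m i).
  rewrite /o /m /orient; move: (d0 i) (d0 (ordS i)); rewrite /d.
  rewrite /dot /=.
  by move=> h h'; field; apply/andP; split.
have mono i : e * m i <= e * m (ordS i).
  have : 0 <= o i Y * dot D D by rewrite mulr_ge0 ?(ltW D0)//; exact: KY.
  by rewrite oE pmulr_rge0 ?mulr_gt0 ?sP// subr_ge0.
have le j i : e * m j <= e * m i.
  apply: (@ordS_ind n (fun i => e * m j <= e * m i) j) => // {}i.
  by move=> /le_trans; apply.
have meq i j : m i = m j.
  have e0 : e != 0 by case: e1 => ->; rewrite ?oppr_eq0 oner_neq0.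
  by apply: (mulfI e0); apply/eqP; rewrite eq_le !le.
have := convP (ordSS_neq n3 i0) (ordS_neq n3 (ordS i0)).
pose Z := (dot D D)^-1 *: (D + m i0 *: (- D.2, D.1)).
have PE i : P i = Y + d i *: Z.
  rewrite /Z (meq i0 i) /m; move: (d0 i) D0; rewrite /d.
  move: (P i) (D) (Y) => [p1 p2] [d1 d2] [y1 y2]; rewrite /dot /= => h D0.
  have D0' := lt0r_neq0 D0.
  by congr pair; rewrite /= /GRing.scale /=; field; rewrite h D0'.
by rewrite /o (collinear_orient (PE _) (PE _) (PE _)) mulr0 ltxx.
Qed.

Definition edge_y A B x : R := A.2 + (x - A.1) / (B.1 - A.1) * (B.2 - A.2).

Let ly i x := edge_y (P i) (P (ordS i)) x.

(** A counterclockwise polygon ([e = 1]) runs rightwards along its lower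
    boundary and leftwards along its upper one, a clockwise one conversely. *)
Definition bottom_side x i : bool :=
  (0 < e * (x - (P i).1)) && (0 < e * ((P (ordS i)).1 - x)).
Definition top_side x i : bool :=
  (0 < e * ((P i).1 - x)) && (0 < e * (x - (P (ordS i)).1)).

Lemma edge_yE A B x : B.1 != A.1 ->
  (x, edge_y A B x) = A + ((x - A.1) / (B.1 - A.1)) *: (B - A).
Proof.
move: A B => [a1 a2] [b1 b2] /= ba; rewrite /edge_y /=; congr pair => /=.
by rewrite /GRing.scale /=; field; rewrite subr_eq0.
Qed.

Lemma orient_edge_y A B x y : B.1 != A.1 ->
  orient A B (x, y) = (B.1 - A.1) * (y - edge_y A B x).
Proof.
move: A B => [a1 a2] [b1 b2] /= ba; rewrite /orient /edge_y /=.
by field; rewrite subr_eq0.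
Qed.

Lemma frac01 (a b x : R) (s : R) : 0 < s * (x - a) -> 0 < s * (b - x) ->
  b != a /\ 0 < (x - a) / (b - a) < 1.
Proof.
move=> xa bx.
have ba : 0 < s * (b - a) by nra.
have ba0 : b - a != 0 by apply: contraTneq ba => ->; rewrite mulr0 ltxx.
split; first by rewrite -subr_eq0.
have s0 : s != 0 by apply: contraTneq ba => ->; rewrite mul0r ltxx.
have -> : (x - a) / (b - a) = (s * (x - a)) / (s * (b - a)).
  by field; rewrite s0 ba0.
rewrite ltr_pdivlMr// ltr_pdivrMr// mul0r mul1r xa /=; nra.
Qed.

Lemma bottom_sideP x i : bottom_side x i ->
  [/\ (P (ordS i)).1 != (P i).1,
      0 < (x - (P i).1) / ((P (ordS i)).1 - (P i).1) < 1 &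
      0 < e * ((P (ordS i)).1 - (P i).1)].
Proof.
move=> /andP[h1 h2]; have [? ?] := frac01 h1 h2; split => //; nra.
Qed.

Lemma top_sideP x i : top_side x i ->
  [/\ (P (ordS i)).1 != (P i).1,
      0 < (x - (P i).1) / ((P (ordS i)).1 - (P i).1) < 1 &
      e * ((P (ordS i)).1 - (P i).1) < 0].
Proof.
move=> /andP[h1 h2].
have h1' : 0 < - e * (x - (P i).1) by nra.
have h2' : 0 < - e * ((P (ordS i)).1 - x) by nra.
by have [? ?] := frac01 h1' h2'; split => //; nra.
Qed.

Let half_planes_edge i x : (P (ordS i)).1 != (P i).1 ->
  0 < (x - (P i).1) / ((P (ordS i)).1 - (P i).1) < 1 ->
  half_planes (x, ly i x).
Proof.
move=> ne /andP[t0 t1]; rewrite edge_yE//.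
by apply: half_planes_segment; [exact: half_planes_vertex..|rewrite !ltW].
Qed.

Lemma bottom_side_le x i y : bottom_side x i -> half_planes (x, y) ->
  ly i x <= y.
Proof.
move=> /bottom_sideP[ne _ se] /(_ i); rewrite orient_edge_y// mulrA.
by rewrite pmulr_rge0// subr_ge0.
Qed.

Lemma top_side_ge x i y : top_side x i -> half_planes (x, y) -> y <= ly i x.
Proof.
move=> /top_sideP[ne _ se] /(_ i); rewrite orient_edge_y// mulrA.
by rewrite nmulr_rge0// subr_le0.
Qed.

(** A nonnegative affine function vanishing at an interior point of side [i] vanishes at both its
    ends, and [o j] vanishes at no vertices but the ends of side [j]. The reversed matching of the
    ends would need [n = 2]. *)
Let edge_uniq x i j : (P (ordS i)).1 != (P i).1 ->
  (P (ordS j)).1 != (P j).1 ->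
  0 < (x - (P i).1) / ((P (ordS i)).1 - (P i).1) < 1 ->
  ly i x = ly j x -> i = j.
Proof.
move=> nei nej /andP[t0 t1] lij.
have : o j (x, ly i x) = 0.
  by rewrite lij /o orient_edge_y// subrr !mulr0.
rewrite edge_yE//; move: t0 t1; set t := (x - _) / _ => t0 t1.
rewrite o_segment => /eqP; rewrite paddr_eq0; last 2 first.
- by rewrite mulr_ge0 ?subr_ge0 ?(ltW t1)//; exact: half_planes_vertex.
- by rewrite mulr_ge0 ?(ltW t0)//; exact: half_planes_vertex.
rewrite (mulf_eq0 (1 - t)) (mulf_eq0 t) subr_eq0 (gt_eqF t1) (gt_eqF t0)/=.
move=> /andP[oi oSi].
have mem k : o j (P k) == 0 -> k = j \/ k = ordS j.
  move=> ok; have [->|kj] := eqVneq k j; first by left.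
  have [->|kSj] := eqVneq k (ordS j); first by right.
  by have := convP kj kSj; rewrite (eqP ok) ltxx.
case: (mem _ oi) => // ij; case: (mem _ oSi) => Sij.
- by have := ordSS_neq n3 j; rewrite -ij Sij eqxx.
- by move/ordS_inj: Sij.
Qed.

Lemma bottom_side_uniq x i j : bottom_side x i -> bottom_side x j -> i = j.
Proof.
move=> bi bj; have [nei ti _] := bottom_sideP bi.
have [nej tj _] := bottom_sideP bj.
apply: (edge_uniq nei nej ti); apply/eqP; rewrite eq_le.
rewrite (bottom_side_le bi (half_planes_edge nej tj)).
by rewrite (bottom_side_le bj (half_planes_edge nei ti)).
Qed.

Lemma top_side_uniq x i j : top_side x i -> top_side x j -> i = j.
Proof.
move=> bi bj; have [nei ti _] := top_sideP bi.
have [nej tj _] := top_sideP bj.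
apply: (edge_uniq nei nej ti); apply/eqP; rewrite eq_le.
rewrite (top_side_ge bi (half_planes_edge nej tj)).
by rewrite (top_side_ge bj (half_planes_edge nei ti)).
Qed.

(** The flag [u i] tells on which side of the vertical line the vertex [i] lies. Bottom sides are
    its changes from true to false, top sides those from false to true, so around the cycle one kind
    cannot occur without the other. Without any change all vertices lie strictly on one side, and
    [half_planes_separation] in a horizontal direction empties the slice. *)
Lemma half_planes_slice x : (forall i, (P i).1 != x) ->
  ((forall y, ~ half_planes (x, y)) /\
   forall i, bottom_side x i = false /\ top_side x i = false) \/
  exists i j, [/\ forall k, bottom_side x k = (k == i),
    forall k, top_side x k = (k == j), ly i x <= ly j x &
    forall y, half_planes (x, y) <-> ly i x <= y <= ly j x].
Proof.
move=> xP; pose u i := 0 < e * (x - (P i).1).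
have uN i : 0 < e * ((P i).1 - x) = ~~ u i.
  rewrite /u -leNgt -opprB mulrN oppr_gt0 lt_neqAle.
  suff -> : e * (x - (P i).1) != 0 by [].
  have e0 : e != 0 by case: e1 => ->; rewrite ?oppr_eq0 oner_neq0.
  by rewrite mulf_neq0// subr_eq0 eq_sym.
have bE i : bottom_side x i = u i && ~~ u (ordS i) by rewrite /bottom_side uN.
have tE i : top_side x i = ~~ u i && u (ordS i) by rewrite /top_side uN.
have [[i bi]|nb] := pselect (exists i, bottom_side x i).
  right; have [j tj] : exists j, top_side x j.
    apply: contrapT => nt.
    move: (bi); rewrite bE => /andP[ui uSi].
    suff : ~~ u i by rewrite ui.
    apply: (@ordS_ind n (fun i => ~~ u i) (ordS i) uSi) => k uk.
    by apply/negP => uSk; apply: nt; exists k; rewrite tE uk.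
  have [nei ti sei] := bottom_sideP bi; have [nej ttj sej] := top_sideP tj.
  have Ki := half_planes_edge nei ti; have Kj := half_planes_edge nej ttj.
  exists i, j; split.
  - move=> k; apply/idP/eqP => [bk|->//]; exact: (bottom_side_uniq bk bi).
  - move=> k; apply/idP/eqP => [tk|->//]; exact: (top_side_uniq tk tj).
  - exact: bottom_side_le.
  - move=> y; split=> [Ky|/andP[iy yj]].
      by rewrite (bottom_side_le bi Ky) (top_side_ge tj Ky).
    have [ij|ij] := eqVneq (ly i x) (ly j x).
      suff -> : y = ly i x by [].
      by apply/eqP; rewrite eq_le iy ij yj.
    have ij0 : 0 < ly j x - ly i x.
      by rewrite subr_gt0 lt_neqAle ij (le_trans iy).
    have -> : (x, y) = (x, ly i x) +
        ((y - ly i x) / (ly j x - ly i x)) *: ((x, ly j x) - (x, ly i x)).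
      congr pair => /=; rewrite /GRing.scale /=.
        by rewrite subrr mulr0 addr0.
      by field; rewrite gt_eqF.
    apply: half_planes_segment => //.
    by rewrite ler_pdivlMr// mul0r subr_ge0 iy ler_pdivrMr// mul1r lerD2r.
left; have ntop i : top_side x i = false.
  apply/negP; rewrite tE => /andP[/negP ui uSi]; apply: ui.
  apply: (@ordS_ind n u (ordS i) uSi) => {uSi}i ui.
  by apply: contrapT => /negP uSi; apply: nb; exists i; rewrite bE ui.
split=> [y|i]; last by split=> //; apply/negP => bi; apply: nb; exists i.
have i0 : 'I_n by case: n n3 => // k _; exact: ord0.
have [ui0|ui0] := boolP (u i0).
  apply: (@half_planes_separation (- e, 0)) => i /=.
  rewrite /dot /= mul0r addr0 mulNr -mulrN opprB -/(u i).
  apply: (@ordS_ind n u i0 ui0) => {}i ui.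
  by apply: contrapT => /negP uSi; apply: nb; exists i; rewrite bE ui.
apply: (@half_planes_separation (e, 0)) => i.
rewrite /dot /= mul0r addr0 uN.
apply: (@ordS_ind n (fun i => ~~ u i) i0 ui0) => {}i ui.
by apply/negP => uSi; have := ntop i; rewrite tE ui uSi.
Qed.

(** A point of larger norm than every vertex would be separated from all of them in the direction
    [- Y]. *)
Lemma half_planes_bound Y : half_planes Y ->
  exists i, dot Y Y <= dot (P i) (P i).
Proof.
move=> KY; apply: contrapT => nP.
apply: (@half_planes_separation (- Y) Y) => // i.
have : dot (P i) (P i) < dot Y Y.
  by rewrite ltNge; apply/negP => h; apply: nP; exists i.
have := dot_self_ge0 (P i - Y).
move: (P i) Y {KY nP} => [p1 p2] [y1 y2]; rewrite /dot /=; lra.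
Qed.

Hypothesis hP : forall i, hplane (P i).

Lemma half_planes_hplane : half_planes `<=` (@hplane R).
Proof. by move=> Y /half_planes_bound[i] /le_lt_trans; apply; exact: hP. Qed.

End ConvexPolygon.

(** * The topological region of a convex polygon *)

Section PolygonRegion.
Variable R : realType.
Implicit Types (A B X Y Z : R * R) (t : R).

Lemma continuous_orient A B : continuous (orient A B).
Proof.
move=> X; rewrite /orient; apply: cvgB; apply: cvgM; try exact: cvg_cst.
  by apply: cvgB; [exact: cvg_snd|exact: cvg_cst].
by apply: cvgB; [exact: cvg_fst|exact: cvg_cst].
Qed.

Lemma continuous_segment A v : continuous (fun t : R => A + t *: v).
Proof.
move=> t; have cD a b : (fun t : R => a + t * b) @ t --> a + t * b.
  by apply: cvgD; [exact: cvg_cst|apply: cvgM; [exact: cvg_id|exact: cvg_cst]].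
exact: (cvg_pair (cD A.1 v.1) (cD A.2 v.2)).
Qed.

Lemma connected_segment A B : connected (segment A B).
Proof.
apply: connected_continuous_connected.
  apply/connected_intervalP => x y /= /andP[x0 _] /andP[_ y1] z /andP[xz zy].
  by rewrite (le_trans x0 xz) (le_trans zy y1).
by apply: continuous_subspaceT; exact: continuous_segment.
Qed.

Lemma dist_ratio_le_expR X Y (M : R) : hplane X -> hplane Y ->
  dist X Y <= M -> dist_ratio X Y <= expR M.
Proof.
move=> hX hY; have r1 := dist_ratio_ge1 hX hY.
have r0 : 0 < dist_ratio X Y by rewrite dist_ratio_gt0.
rewrite /dist -/(dist_ratio X Y) /arcosh => dM.
rewrite -ler_ln ?posrE ?expR_gt0// expRK; apply: le_trans dM.
have s0 := sqrtr_ge0 (dist_ratio X Y ^+ 2 - 1).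
by rewrite ler_ln ?posrE; lra.
Qed.

Lemma hplane_ray_unbounded X (v : R * R) (M : R) : hplane X -> 0 < dot v v ->
  exists s, [/\ 0 <= s, hplane (X + s *: v) & M < dist X (X + s *: v)].
Proof.
move=> hX v0; have lX := hplane_sqrt_gt0 hX; have x0 := hplane_gt0 hX.
set l := Num.sqrt _ in lX.
have l2 : l ^+ 2 = 1 - dot X X by rewrite sqr_sqrtr// ltW.
have eM := expR_gt0 M.
(* The ray is followed until [dot Y Y = 1 - c ^+ 2]. Since [1 - dot X Y >= l ^+ 2 / 2], the distance
   ratio there is at least [l / (2 * c)], which this [c] makes equal to [expR M + 1]. *)
pose c := l / (2 * (expR M + 1)).
have c0 : 0 < c by rewrite divr_gt0// mulr_gt0//; lra.
have cl : c < l by rewrite /c ltr_pdivrMr; nra.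
pose k := 1 - c ^+ 2 - dot X X.
have k0 : 0 < k by rewrite /k; nra.
pose q := dot X v ^+ 2 + dot v v * k.
have q0 : 0 <= q by rewrite addr_ge0 ?sqr_ge0 ?mulr_ge0 ?ltW.
(* The nonnegative root of the quadratic equation [dot Y Y = 1 - c ^+ 2] for [Y = X + s *: v]. *)
pose s := (Num.sqrt q - dot X v) / dot v v.
have s0 : 0 <= s.
  rewrite divr_ge0 ?(ltW v0)// subr_ge0.
  apply: le_trans (ler_norm _) _; rewrite -sqrtr_sqr ler_wsqrtr// /q lerDl.
  by rewrite mulr_ge0// ltW.
have YY : dot (X + s *: v) (X + s *: v) = 1 - c ^+ 2.
  have -> : dot (X + s *: v) (X + s *: v) =
      dot X X + 2 * s * dot X v + s ^+ 2 * dot v v.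
    move: (X) (v) (s) => [x1 x2] [v1 v2] u.
    by rewrite /dot /= /GRing.scale /=; ring.
  have sq : Num.sqrt q ^+ 2 = q by rewrite sqr_sqrtr.
  have -> : dot X X + 2 * s * dot X v + s ^+ 2 * dot v v =
      dot X X + (Num.sqrt q ^+ 2 - dot X v ^+ 2) / dot v v.
    by rewrite /s; field; rewrite gt_eqF.
  by rewrite sq /q /k; field; rewrite gt_eqF.
have hY : hplane (X + s *: v).
  by rewrite /hplane /= YY gtrBl exprn_gt0.
exists s; split => //; rewrite ltNge; apply/negP.
move/(dist_ratio_le_expR hX hY); apply/negP; rewrite -ltNge /dist_ratio.
rewrite YY opprB addrCA subrr addr0 sqrtr_sqr (gtr0_norm c0) -/l.
have XY : l ^+ 2 / 2 <= 1 - dot X (X + s *: v).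
  have := dot_self_ge0 (X - (X + s *: v)).
  have := hplane_gt0 hY; rewrite l2.
  move: (X + s *: v) => Y; move: (X) (Y) => [x1 x2] [y1 y2].
  by rewrite /dot /=; lra.
apply: lt_le_trans (_ : expR M + 1 <= _); first by lra.
rewrite ler_pdivlMr ?mulr_gt0//; apply: le_trans XY.
rewrite le_eqVlt; apply/orP; left; apply/eqP; rewrite /c.
by field; rewrite gt_eqF//; lra.
Qed.

Variable n : nat.
Hypothesis n3 : (3 <= n)%N.
Variables (P : 'I_n -> R * R) (e : R).
Hypothesis hP : forall i, hplane (P i).
Hypothesis e1 : e = 1 \/ e = - 1.
Hypothesis convP : forall i k, k != i -> k != ordS i ->
  0 < e * orient (P i) (P (ordS i)) (P k).

Let o i X := e * orient (P i) (P (ordS i)) X.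

Let continuous_o i : continuous (o i).
Proof.
by move=> X; apply: cvgM; [exact: cvg_cst|exact: continuous_orient].
Qed.

Let boundary_half_planes : polygon_boundary P `<=` half_planes P e.
Proof.
move=> _ [i _ [t /= t01 <-]].
by apply: half_planes_segment => //; exact: half_planes_vertex.
Qed.

(** From a point outside some half-plane, the ray parallel to the corresponding side never enters
    that half-plane, so it avoids the boundary while its distance to the start is unbounded. For a
    point inside, off the boundary the weak and the strict inequalities agree, so [half_planes] is
    open and closed in the component; the component stays in it, and [half_planes_bound] bounds its
    distances. *)
Lemma polygon_region_half_planes : polygon_region P = half_planes P e.
Proof.
apply/seteqP; split=> X.
  case=> [|[hX nX [M XM]]]; first exact: boundary_half_planes.
  apply: contrapT => /existsNP[i /negP]; rewrite -ltNge => oX.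
  have v0 := dot_self_gt0 (convex_vertex_neq n3 convP i).
  set v := P (ordS i) - P i in v0.
  have [s [s0 hY dY]] := hplane_ray_unbounded M hX v0.
  suff : connected_component (hplane (R:=R) `\` polygon_boundary P) X
      (X + s *: v) by move/XM; rewrite leNgt dY.
  have seg1 : segment X (X + s *: v) (X + s *: v).
    by exists 1; rewrite /= ?lexx ?ler01// scale1r addrC subrK.
  apply: connected_component_max seg1.
  - by exists 0; rewrite /= ?lexx ?ler01// scale0r addr0.
  - move=> _ [t /= t01 <-]; split; first exact: hplane_segment.
    move/boundary_half_planes/(_ i); apply/negP; rewrite -ltNge.
    suff -> : orient (P i) (P (ordS i)) (X + t *: (X + s *: v - X)) =
      orient (P i) (P (ordS i)) X by [].
    rewrite /v; move: (P i) (P (ordS i)) X {hX nX XM oX hY dY}.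
    move=> [a1 a2] [b1 b2] [x1 x2].
    by rewrite /orient /= /GRing.scale /=; ring.
  - exact: connected_segment.
move=> KX; have hX := half_planes_hplane n3 e1 convP hP KX.
have [bX|nX] := pselect (polygon_boundary P X); [by left|right; split=> //].
have pos Y : half_planes P e Y -> ~ polygon_boundary P Y -> forall i, 0 < o i Y.
  move=> KY nY i; rewrite lt_neqAle (KY i : 0 <= o i Y) andbT eq_sym.
  apply/eqP => oY; apply: nY; exists i => //.
  apply: (half_planes_side n3 convP KY); move/eqP: oY; rewrite mulf_eq0.
  by case: e1 => ->; rewrite ?oppr_eq0 oner_eq0 => /eqP.
set C := connected_component _ X.
have CX : C X by apply: connected_component_refl.
have CK : C `&` half_planes P e = C.
  apply: component_connected.
  - by exists X.
  - exists [set Y | forall i, 0 < o i Y].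
      rewrite openE => Y oY.
      apply: (@filter_forall _ _ (fun i Z => 0 < o i Z) (nbhs Y)) => i.
      have := @continuous_o i Y.
      by move=> /cvgr_gt; apply.
    apply/seteqP; split=> Y [CY KY]; split=> //.
      apply: pos => // bY.
      by have [_] := connected_component_sub CY.
    by move=> i; exact/ltW/KY.
  - exists (half_planes P e) => //.
    have -> : half_planes P e = \bigcap_i (o i @^-1` [set x | 0 <= x]).
      by apply/seteqP; split=> [Y KY i _|Y KY i]; [exact: KY|exact: (KY i)].
    apply: closed_bigI => i _; apply: preimage_closed; last exact: closed_ge.
    by move=> ? _; exact: continuous_o.
(* A sum of nonnegative terms stands in for the maximum over the vertices; the numerator 2 bounds
   [1 - dot X Y]. *)
pose M := \sum_(i < n) arcosh (2 / (Num.sqrt (1 - dot X X) *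
  Num.sqrt (1 - dot (P i) (P i)))).
exists M => Y; rewrite -/C -CK => -[_ KY].
have hY := half_planes_hplane n3 e1 convP hP KY.
have lX := hplane_sqrt_gt0 hX; have lY := hplane_sqrt_gt0 hY.
have XY2 : 1 - dot X Y <= 2.
  have := dot_self_ge0 (X + Y); move: hX hY; rewrite /hplane /=.
  by move: (X) (Y) => [x1 x2] [y1 y2]; rewrite /dot /=; lra.
have le i : dot Y Y <= dot (P i) (P i) -> dist_ratio X Y <=
    2 / (Num.sqrt (1 - dot X X) * Num.sqrt (1 - dot (P i) (P i))).
  move=> YP; have lP := hplane_sqrt_gt0 (hP i).
  rewrite /dist_ratio; apply: ler_pM => //.
  - exact/ltW/hplane_dot_gt0/ltW.
  - rewrite lef_pV2 ?posrE ?mulr_gt0//.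
    by rewrite ler_pM2l// ler_wsqrtr// lerD2l lerN2.
have arcosh_ge0 (t : R) : 1 <= t -> 0 <= arcosh t.
  by move=> t1; rewrite ln_ge0//; have := sqrtr_ge0 (t ^+ 2 - 1); lra.
have [i YP] := half_planes_bound n3 e1 convP KY.
apply: le_trans (arcosh_le (dist_ratio_ge1 hX hY) (le i YP)) _.
rewrite /M (bigD1 i)//= lerDl sumr_ge0// => j _; apply: arcosh_ge0.
have lP := hplane_sqrt_gt0 (hP j).
rewrite ler_pdivlMr ?mulr_gt0// mul1r.
have l1 Z : Num.sqrt (1 - dot Z Z) <= 1.
  by rewrite -[leRHS]sqrtr1 ler_wsqrtr// gerBl dot_self_ge0.
have := l1 X; have := l1 (P j); nra.
Qed.

End PolygonRegion.

(** * Green's formula *)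

Section EdgeIntegral.
Variable R : realType.
Implicit Types (A B X Y Z : R * R) (t : R).
Local Notation mu := (@lebesgue_measure R).

Lemma integral_derive (F f : R -> R) (a b : R) : a <= b ->
  (forall t, a <= t <= b -> is_derive t 1 F (f t)) ->
  (forall t, a <= t <= b -> {for t, continuous f}) ->
  (\int[mu]_(t in `[a, b]) (f t)%:E)%E = (F b - F a)%:E.
Proof.
rewrite le_eqVlt => /predU1P[<- _ _|ab dF cf].
  by rewrite set_itv1 integral_set1 subrr.
have cF t : a <= t <= b -> {for t, continuous F}.
  move=> /dF [dFt _]; apply: differentiable_continuous.
  exact/derivable1_diffP.
rewrite (@continuous_FTC2 _ f F) ?EFinB//.
- apply: continuous_in_subspaceT => t /set_mem /=; rewrite in_itv /=.
  exact: cf.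
- split.
  + move=> t /[!in_itv] /= /andP[/ltW at' /ltW tb].
    by have [] := dF t; rewrite ?at' ?tb.
  + by apply: cvg_at_right_filter; apply: cF; rewrite lexx ltW.
  + by apply: cvg_at_left_filter; apply: cF; rewrite lexx ltW.
- move=> t /[!in_itv] /= /andP[/ltW at' /ltW tb].
  have dFt : is_derive t 1 F (f t) by apply: dF; rewrite at' tb.
  by rewrite derive1E derive_val.
Qed.

(** The affine parameter, unlike an abscissa or an ordinate, treats vertical and horizontal sides
    alike, so the results of slicing in the two directions can be added side by side. *)
Definition edge_int (g : R * R -> R) A B : R :=
  \int[mu]_(t in `[0, 1]) g (A + t *: (B - A)).

Lemma edge_continuous (g : R * R -> R) A B t :
  {for A + t *: (B - A), continuous g} ->
  {for t, continuous (fun t => g (A + t *: (B - A)))}.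
Proof.
move=> cg; apply: (@continuous_comp _ _ _ (fun t => A + t *: (B - A)) g) => //.
exact: continuous_segment.
Qed.

Lemma edge_integrable (g : R * R -> R) A B :
  (forall t, 0 <= t <= 1 -> {for A + t *: (B - A), continuous g}) ->
  mu.-integrable `[0, 1] (fun t => (g (A + t *: (B - A)))%:E).
Proof.
move=> cg; apply: continuous_compact_integrable; first exact: segment_compact.
apply: continuous_in_subspaceT => t /set_mem /=; rewrite in_itv /= => t01.
by apply: edge_continuous; exact: cg.
Qed.

Lemma edge_y_continuous (g : R * R -> R) A B x : B.1 != A.1 ->
  {for (x, edge_y A B x), continuous g} ->
  {for x, continuous (fun x => g (x, edge_y A B x))}.
Proof.
move=> ne cg.
apply: (@continuous_comp _ _ _ (fun x => (x, edge_y A B x)) g) => //.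
suff cy : edge_y A B @ x --> edge_y A B x by exact: (cvg_pair cvg_id cy).
apply: cvgD; first exact: cvg_cst.
apply: cvgM; last exact: cvg_cst.
apply: cvgM; last exact: cvg_cst.
by apply: cvgB; [exact: cvg_id|exact: cvg_cst].
Qed.

Lemma edge_y_segment A B t : B.1 != A.1 ->
  let x := A.1 + t * (B.1 - A.1) in (x, edge_y A B x) = A + t *: (B - A).
Proof.
move=> ne /=; rewrite edge_yE//; congr (_ + _ *: _).
by rewrite addrC addKr mulfK// subr_eq0.
Qed.

Lemma is_derive_affine (a b t : R) : is_derive t 1 (fun t : R => a + t * b) b.
Proof.
have h := is_deriveD (is_derive_cst a t 1)
  (is_deriveM (is_derive_id t 1) (is_derive_cst b t 1)).
by apply: is_derive_eq h _; rewrite scaler0 !add0r /GRing.scale /= mulr1.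
Qed.

Let derive1_affine (a b : R) : derive1 (fun t : R => a + t * b : R) = cst b.
Proof.
apply/funext => t; rewrite derive1E.
by have h := is_derive_affine a b t; rewrite derive_val.
Qed.

Let derivable_affine (a b t : R) : derivable (fun t => a + t * b) t 1.
Proof. by apply: derivableD => //; apply: derivableM. Qed.

Let continuous_affine (a b : R) : continuous (fun t => a + t * b).
Proof.
move=> t; apply: cvgD; first exact: cvg_cst.
by apply: cvgM; [exact: cvg_id|exact: cvg_cst].
Qed.

Let derivable_oo_affine (a b x y : R) :
  derivable_oo_LRcontinuous (fun t => a + t * b) x y.
Proof.
split; first by move=> t _; exact: derivable_affine.
- by apply: cvg_at_right_filter; exact: continuous_affine.
- by apply: cvg_at_left_filter; exact: continuous_affine.
Qed.

Let edge_integralZ (g : R * R -> R) A B (c : R) :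
  (forall t, 0 <= t <= 1 -> {for A + t *: (B - A), continuous g}) ->
  (\int[mu]_(t in `[0%R, 1%R]) (g (A + t *: (B - A)) * c)%:E)%E =
  (c * edge_int g A B)%:E.
Proof.
move=> cg; have ig := edge_integrable cg.
under eq_integral do rewrite mulrC EFinM.
rewrite integralZl//= EFinM; congr (_ * _)%E.
by rewrite /edge_int /Rintegral fineK//; exact: integrable_fin_num.
Qed.

Lemma edge_integral_lt (g : R * R -> R) A B : A.1 < B.1 ->
  (forall t, 0 <= t <= 1 -> {for A + t *: (B - A), continuous g}) ->
  (\int[mu]_(x in `[A.1, B.1]) (g (x, edge_y A B x))%:E)%E =
  ((B.1 - A.1) * edge_int g A B)%:E.
Proof.
move=> AB cg; have ne : B.1 != A.1 by rewrite gt_eqF.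
have d0 : 0 < B.1 - A.1 by rewrite subr_gt0.
pose F t := A.1 + t * (B.1 - A.1).
have -> : A.1 = F 0 by rewrite /F mul0r addr0.
have -> : B.1 = F 1 by rewrite /F mul1r addrC subrK.
rewrite (@integration_by_substitution_increasing _ F
  (fun x => g (x, edge_y A B x)))//.
- have -> : F 1 - F 0 = B.1 - A.1 by rewrite /F; ring.
  rewrite -edge_integralZ//; apply: eq_integral => t _.
  by rewrite /F !fctE derive1_affine /= edge_y_segment.
- by move=> x y _ _ xy; rewrite ltrD2l ltr_pM2r.
- by rewrite derive1_affine => ? _; exact: cvg_cst.
- by rewrite derive1_affine; exact: is_cvg_cst.
- by rewrite derive1_affine; exact: is_cvg_cst.
- exact: derivable_oo_affine.
- apply: continuous_in_subspaceT => x /set_mem /=; rewrite in_itv /= => /andP[].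
  rewrite /F mul0r mul1r addr0 addrC => Ax xB; apply: edge_y_continuous => //.
  rewrite edge_yE//; apply: cg; rewrite ler_pdivlMr// mul0r subr_ge0 Ax.
  by rewrite ler_pdivrMr// mul1r lerBlDr.
Qed.

Lemma edge_integral_gt (g : R * R -> R) A B : B.1 < A.1 ->
  (forall t, 0 <= t <= 1 -> {for A + t *: (B - A), continuous g}) ->
  (\int[mu]_(x in `[B.1, A.1]) (g (x, edge_y A B x))%:E)%E =
  ((A.1 - B.1) * edge_int g A B)%:E.
Proof.
move=> AB cg; have ne : B.1 != A.1 by rewrite lt_eqF.
have d0 : 0 < A.1 - B.1 by rewrite subr_gt0.
pose F t := A.1 + t * (B.1 - A.1).
have -> : A.1 = F 0 by rewrite /F mul0r addr0.
have -> : B.1 = F 1 by rewrite /F mul1r addrC subrK.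
rewrite (@integration_by_substitution_decreasing _ F
  (fun x => g (x, edge_y A B x)))//.
- have -> : F 0 - F 1 = - (B.1 - A.1) by rewrite /F; ring.
  rewrite -edge_integralZ//; apply: eq_integral => t _.
  by rewrite /F !fctE derive1_affine /= edge_y_segment.
- by move=> x y _ _ xy; rewrite ltrD2l ltr_nM2r// subr_lt0.
- by rewrite derive1_affine => ? _; exact: cvg_cst.
- by rewrite derive1_affine; exact: is_cvg_cst.
- by rewrite derive1_affine; exact: is_cvg_cst.
- exact: derivable_oo_affine.
- apply: continuous_in_subspaceT => x /set_mem /=; rewrite in_itv /= => /andP[].
  rewrite /F mul0r mul1r addr0 addrC subrK => Bx xA.
  apply: edge_y_continuous => //.
  rewrite edge_yE//; apply: cg; rewrite -[_ / _]mulrNN -invrN !opprB.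
  by rewrite ler_pdivlMr// mul0r subr_ge0 xA ler_pdivrMr// mul1r lerD2l lerN2.
Qed.

End EdgeIntegral.

(** * Slicing the polygon by vertical lines *)

Section IteratedIntegral.
Variable R : realType.
Local Notation mu := (@lebesgue_measure R).

(** [top_side] and [bottom_side] are strict, so a side contributes on an open interval, while the
    substitution along the side runs over the closed one. *)
Lemma integral_patch_open (h : R -> R) (a b : R) : a < b ->
  (forall x, a <= x <= b -> {for x, continuous h}) ->
  mu.-integrable setT (EFin \o (h \_ `]a, b[)) /\
  (\int[mu]_x ((h \_ `]a, b[) x)%:E)%E = (\int[mu]_(x in `[a, b]) (h x)%:E)%E.
Proof.
move=> ab ch.
have ih : mu.-integrable `[a, b] (EFin \o h).
  apply: continuous_compact_integrable; first exact: segment_compact.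
  apply: continuous_in_subspaceT => x /set_mem /=; rewrite in_itv /=.
  exact: ch.
have ih' : mu.-integrable `]a, b[ (EFin \o h).
  by apply: integrableS ih => //; exact: subset_itv_oo_cc.
split.
  by rewrite -restrict_EFin; apply/integrable_restrict => //; rewrite setTI.
rewrite integral_itv_bndoo; last exact: measurable_int ih'.
by rewrite [RHS]integral_mkcond restrict_EFin.
Qed.

Variable n : nat.
Hypothesis n3 : (3 <= n)%N.
Variables (P : 'I_n -> R * R) (e : R).
Hypothesis hP : forall i, hplane (P i).
Hypothesis e1 : e = 1 \/ e = - 1.
Hypothesis convP : forall i k, k != i -> k != ordS i ->
  0 < e * orient (P i) (P (ordS i)) (P k).
Variables f g : R * R -> R.
Hypothesis df : forall x y, hplane (x, y) ->
  is_derive y 1 (fun y => g (x, y)) (f (x, y)).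
Hypothesis cf : forall X, hplane X -> {for X, continuous f}.
Hypothesis cg : forall X, hplane X -> {for X, continuous g}.

Let K := half_planes P e.
Let ly i x := edge_y (P i) (P (ordS i)) x.
(** The value at the top minus the value at the bottom of a slice, spread over all sides so that the
    sum can be exchanged with the integral in [x]. *)
Let term i x := ((top_side P e x i)%:R - (bottom_side P e x i)%:R) *
  g (x, ly i x).

Let slice_integral x : (forall i, (P i).1 != x) ->
  (\int[mu]_y ((f \_ K) (x, y))%:E)%E = (\sum_(i < n) term i x)%:E.
Proof.
move=> xP.
have [[nK nbt]|[i [j [bi tj lij KE]]]] := half_planes_slice n3 e1 convP xP.
  rewrite big1; last first.
    by move=> i _; rewrite /term; have [-> ->] := nbt i; rewrite subrr mul0r.
  rewrite integral0_eq// => y _; rewrite patchE; case: ifPn => // /set_mem.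
  by move/nK.
have -> : \sum_(k < n) term k x = g (x, ly j x) - g (x, ly i x).
  under eq_bigr do rewrite /term bi tj mulrBl.
  rewrite sumrB; congr (_ - _).
    rewrite (bigD1 j)//= eqxx mul1r big1 ?addr0// => k /negPf ->.
    by rewrite mul0r.
  rewrite (bigD1 i)//= eqxx mul1r big1 ?addr0// => k /negPf ->.
  by rewrite mul0r.
have hK y : ly i x <= y <= ly j x -> hplane (x, y).
  by move=> /KE; exact: (half_planes_hplane n3 e1 convP hP).
transitivity (\int[mu]_(y in `[(ly i x)%R, (ly j x)%R]) (f (x, y))%:E)%E.
  rewrite [RHS]integral_mkcond; apply: eq_integral => y _.
  rewrite !patchE; case: ifPn => [/set_mem/KE yK|/negP nK].
    by rewrite mem_set//= in_itv.
  by rewrite memNset//= in_itv /= => /KE yK; apply: nK; rewrite mem_set.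
apply: (@integral_derive _ (fun y => g (x, y)) (fun y => f (x, y))) => //.
- by move=> y /hK; exact: df.
- move=> y /hK hy.
  apply: (@continuous_comp _ _ _ (fun y => (x, y)) f); last exact: cf.
  exact: (cvg_pair (cvg_cst x) cvg_id).
Qed.

Let between_pos (a b x : R) : a < b ->
  (0 < e * (x - a)) && (0 < e * (b - x)) = (0 < e) && (x \in `]a, b[).
Proof.
move=> ab; rewrite in_itv /=; case: e1 => ->.
  by rewrite ltr01 !mul1r !subr_gt0.
rewrite oppr_gt0 ltr10 !mulN1r !oppr_gt0 !subr_lt0 /=.
by apply/negP => /andP[xa /(lt_trans ab)]; rewrite ltNge (ltW xa).
Qed.

Let between_neg (a b x : R) : a < b ->
  (0 < e * (a - x)) && (0 < e * (x - b)) = (e < 0) && (x \in `]a, b[).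
Proof.
move=> ab; rewrite in_itv /=; case: e1 => ->.
  rewrite ltr10 !mul1r !subr_gt0 /=.
  by apply/negP => /andP[xa /(lt_trans ab)]; rewrite ltNge (ltW xa).
by rewrite oppr_lt0 ltr01 !mulN1r !oppr_gt0 !subr_lt0.
Qed.

Let sign_diff : (e < 0)%R%:R - (0 < e)%R%:R = - e :> R.
Proof.
case: e1 => ->; first by rewrite ltr10 ltr01 sub0r.
by rewrite oppr_lt0 oppr_gt0 ltr01 ltr10 subr0 opprK.
Qed.

(** A side running rightwards is a bottom side for [e = 1] and a top side for [e = - 1], hence the
    sign [- e]; for a side running leftwards the sign of the width also changes, and a vertical side
    contributes nothing. *)
Let term_integral i :
  mu.-integrable setT (EFin \o term i) /\
  (\int[mu]_x (term i x)%:E)%E =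
  (- e * ((P (ordS i)).1 - (P i).1) * edge_int g (P i) (P (ordS i)))%:E.
Proof.
set A := P i; set B := P (ordS i).
have cseg t : 0 <= t <= 1 -> {for A + t *: (B - A), continuous g}.
  by move=> t01; apply: cg; apply: hplane_segment t01; exact: hP.
have cedge x : B.1 != A.1 -> 0 <= (x - A.1) / (B.1 - A.1) <= 1 ->
    {for x, continuous (fun x => g (x, edge_y A B x))}.
  move=> ne x01; apply: edge_y_continuous => //.
  by rewrite edge_yE//; exact: cseg.
have cedgeZ c x : {for x, continuous (fun x => g (x, edge_y A B x))} ->
    {for x, continuous (fun x => c * g (x, edge_y A B x))}.
  by move=> cx; apply: cvgM => //; exact: cvg_cst.
have [AB|BA|AB] := ltrgtP A.1 B.1.
- have ch x : A.1 <= x <= B.1 ->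
      {for x, continuous (fun x => - e * g (x, edge_y A B x))}.
    move=> /andP[Ax xB]; apply/cedgeZ/cedge; first by rewrite gt_eqF.
    by rewrite ler_pdivlMr ?subr_gt0// mul0r subr_ge0 Ax
      ler_pdivrMr ?subr_gt0// mul1r lerD2r.
  have [] := integral_patch_open AB ch.
  have -> : (fun x => - e * g (x, edge_y A B x)) \_ `]A.1, B.1[ = term i.
    apply/funext => x; rewrite patchE /term /top_side /bottom_side -/A -/B.
    rewrite (between_pos _ AB) (between_neg _ AB).
    rewrite mem_setE; case: ifP => _; last by rewrite !andbF subrr mul0r.
    by rewrite !andbT sign_diff.
  move=> ih ->; rewrite -mulrA; split => //.
  under eq_integral do rewrite EFinM.
  rewrite integralZl//=; last first.
    apply: continuous_compact_integrable; first exact: segment_compact.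
    apply: continuous_in_subspaceT => x /set_mem /=.
    rewrite in_itv /= => /andP[Ax xB]; apply/cedge; first by rewrite gt_eqF.
    by rewrite ler_pdivlMr ?subr_gt0// mul0r subr_ge0 Ax
      ler_pdivrMr ?subr_gt0// mul1r lerD2r.
  by rewrite edge_integral_lt.
- have frac x : B.1 <= x <= A.1 -> 0 <= (x - A.1) / (B.1 - A.1) <= 1.
    move=> /andP[Bx xA]; rewrite -[_ / _]mulrNN -invrN !opprB.
    by rewrite ler_pdivlMr ?subr_gt0// mul0r subr_ge0 xA
      ler_pdivrMr ?subr_gt0// mul1r lerD2l lerN2.
  have ch x : B.1 <= x <= A.1 ->
      {for x, continuous (fun x => e * g (x, edge_y A B x))}.
    by move=> /frac x01; apply/cedgeZ/cedge => //; rewrite lt_eqF.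
  have [] := integral_patch_open BA ch.
  have -> : (fun x => e * g (x, edge_y A B x)) \_ `]B.1, A.1[ = term i.
    apply/funext => x; rewrite patchE /term /top_side /bottom_side -/A -/B.
    rewrite (andbC (0 < _ * (A.1 - x))) (between_pos _ BA).
    rewrite (andbC (0 < _ * (x - A.1))) (between_neg _ BA).
    rewrite mem_setE; case: ifP => _; last by rewrite !andbF subrr mul0r.
    by rewrite !andbT -[(0 < e)%R%:R - _]opprB sign_diff opprK.
  move=> ih ->; split => //.
  have -> : - e * (B.1 - A.1) * edge_int g A B =
    e * ((A.1 - B.1) * edge_int g A B) by ring.
  under eq_integral do rewrite EFinM.
  rewrite integralZl//=; last first.
    apply: continuous_compact_integrable; first exact: segment_compact.
    apply: continuous_in_subspaceT => x /set_mem /=.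
    by rewrite in_itv /= => /frac x01; apply/cedge => //; rewrite lt_eqF.
  by rewrite edge_integral_gt.
- have -> : term i = cst 0.
    apply/funext => x; rewrite /term /top_side /bottom_side -/A -/B -AB.
    have -> : (0 < e * (A.1 - x)) && (0 < e * (x - A.1)) = false.
      by apply/negP => /andP[h1 h2]; lra.
    have -> : (0 < e * (x - A.1)) && (0 < e * (A.1 - x)) = false.
      by apply/negP => /andP[h1 h2]; lra.
    by rewrite subrr mul0r.
  split; first exact: integrable0.
  by rewrite AB subrr mulr0 mul0r integral0_eq.
Qed.

Hypothesis iK : (mu \x mu)%E.-integrable setT (EFin \o (f \_ K)).

Lemma iterated_integral :
  (\int[mu]_x \int[mu]_y ((f \_ K) (x, y))%:E)%E =
  (\sum_(i < n) - e * ((P (ordS i)).1 - (P i).1) *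
     edge_int g (P i) (P (ordS i)))%:E.
Proof.
have it (i : 'I_n) : mu.-integrable setT (EFin \o term i).
  by case: (term_integral i).
transitivity (\int[mu]_x (\sum_(i < n) (term i x)%:E))%E; last first.
  rewrite integral_sum// -sumEFin.
  by apply: eq_bigr => i _; case: (term_integral i).
apply: ae_eq_integral => //.
- exact: measurable_fubini_F iK.
- apply: measurable_int.
  exact: (integrable_sum measurableT (index_enum 'I_n)
    (fun i (_ : true) => it i)).
(* The abscissas of the vertices, where [slice_integral] says nothing, form a finite and hence null
   set. *)
have cN : countable [set (P i).1 | i in [set: 'I_n]].
  by apply/finite_set_countable/finite_image/finite_finset.
exists [set (P i).1 | i in [set: 'I_n]]; split.
- exact: countable_measurable.
- exact: countable_lebesgue_measure0.
move=> x /= nx; apply: contrapT => xP; apply: nx => _.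
rewrite sumEFin slice_integral// => i.
by apply/eqP => Px; apply: xP; exists i.
Qed.

End IteratedIntegral.

Lemma measurable_funV_pos d (T : measurableType d) (R : realType) (D : set T)
    (h : T -> R) : (forall x, D x -> 0 < h x) -> measurable_fun D h ->
  measurable_fun D (fun x => (h x)^-1).
Proof.
move=> h0 mh; apply: (eq_measurable_fun (fun x => powR (h x) (-1))).
  by move=> x /set_mem/h0 /ltW hx; rewrite powR_inv1.
exact: measurableT_comp (measurable_powR _) mh.
Qed.

(** * Green's formula in each coordinate direction *)

Section HalfPlanesIntegral.
Variables (R : realType) (n : nat).
Local Notation mu := (@lebesgue_measure R).
Local Notation mu2 := (mu \x mu)%E.
Hypothesis n3 : (3 <= n)%N.

Lemma orient_swap (A B X : R * R) :
  orient (swap_pair A) (swap_pair B) (swap_pair X) = - orient A B X.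
Proof.
by move: A B X => [a1 a2] [b1 b2] [x1 x2]; rewrite /orient /=; ring.
Qed.

(** Reflection in the diagonal turns horizontal slices into vertical ones and reverses the
    orientation, whence [- e]. *)
Lemma half_planes_swap (P : 'I_n -> R * R) (e : R) X :
  half_planes (fun i => swap_pair (P i)) (- e) (swap_pair X) =
  half_planes P e X.
Proof.
apply/propext; split=> KX i; have := KX i;
  by rewrite orient_swap mulrNN.
Qed.

Lemma hplane_swap (X : R * R) : hplane (swap_pair X) = hplane X.
Proof. by rewrite /hplane /dot /= addrC. Qed.

Lemma measurable_orient (A B : R * R) : measurable_fun setT (orient A B).
Proof.
by apply: measurable_funB; apply: measurable_funM => //;
  apply: measurable_funB => //.
Qed.

Lemma measurable_half_planes (P : 'I_n -> R * R) (e : R) :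
  measurable (half_planes P e).
Proof.
have -> : half_planes P e =
    \bigcap_i ((fun X => e * orient (P i) (P (ordS i)) X) @^-1` `[0, +oo[).
  apply/seteqP; split=> [X KX i _|X KX i]; first by rewrite /= in_itv /= KX.
  by have := KX i I; rewrite /= in_itv /= andbT.
apply: fin_bigcap_measurable => // i _; rewrite -[X in measurable X]setTI.
have m : measurable_fun setT (fun X => e * orient (P i) (P (ordS i)) X).
  by apply: measurable_funM => //; exact: measurable_orient.
by apply: m.
Qed.

Section Oriented.
Variables (P : 'I_n -> R * R) (e : R).
Hypothesis hP : forall i, hplane (P i).
Hypothesis e1 : e = 1 \/ e = - 1.
Hypothesis convP : forall i k, k != i -> k != ordS i ->
  0 < e * orient (P i) (P (ordS i)) (P k).
Let K := half_planes P e.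

Lemma half_planes_lb : exists2 dlt : R, 0 < dlt &
  forall X, K X -> dlt <= 1 - dot X X.
Proof.
(* All factors lie in []0, 1]], so the product is a positive lower bound of each of them. *)
exists (\prod_(i < n) (1 - dot (P i) (P i))).
  by rewrite prodr_gt0// => i _; exact: hplane_gt0.
move=> X KX; have [i XP] := half_planes_bound n3 e1 convP KX.
have le : 1 - dot (P i) (P i) <= 1 - dot X X by rewrite lerD2l lerN2.
apply: le_trans le; rewrite (bigD1 i)//= ler_piMr//.
  exact/ltW/hplane_gt0.
apply: prodr_ile1 => j _; rewrite gerBl dot_self_ge0 andbT.
exact/ltW/hplane_gt0.
Qed.

Lemma half_planes_finite : (mu2 K < +oo)%E.
Proof.
apply: (@le_lt_trans _ _ (mu2 (`[-1, 1] `*` `[-1, 1]))).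
  apply: le_measure; rewrite ?inE.
  - exact: measurable_half_planes.
  - exact: measurableX.
  move=> X /(half_planes_hplane n3 e1 convP hP).
  case: X => x y; rewrite /hplane /dot /= !in_itv /= => xy.
  by split; apply/andP; split; nra.
rewrite product_measure1E//= lebesgue_measure_itv/=.
by case: ifP => _; rewrite -?EFinD ?mule0 ?mul0e// -EFinM ltry.
Qed.

Lemma half_planes_integrable (f : R * R -> R) : measurable_fun K f ->
  (exists M, forall X, K X -> `|f X| <= M) -> mu2.-integrable K (EFin \o f).
Proof.
move=> mf [M fM]; apply: measurable_bounded_integrable => //.
- exact: measurable_half_planes.
- exact: half_planes_finite.
exists M; split; first exact: num_real.
by move=> M' /ltW MM' X KX /=; rewrite (le_trans (fM _ KX)).
Qed.

End Oriented.

Lemma half_planes_integral_dy (P : 'I_n -> R * R) (e : R) (f g : R * R -> R) :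
  (forall i, hplane (P i)) -> e = 1 \/ e = - 1 ->
  (forall i k, k != i -> k != ordS i ->
    0 < e * orient (P i) (P (ordS i)) (P k)) ->
  (forall x y, hplane (x, y) ->
    is_derive y 1 (fun y => g (x, y)) (f (x, y))) ->
  (forall X, hplane X -> {for X, continuous f}) ->
  (forall X, hplane X -> {for X, continuous g}) ->
  mu2.-integrable (half_planes P e) (EFin \o f) ->
  (\int[mu2]_(X in half_planes P e) (f X)%:E)%E =
  (\sum_(i < n) - e * ((P (ordS i)).1 - (P i).1) *
     edge_int g (P i) (P (ordS i)))%:E.
Proof.
move=> hP e1 convP df cf cg iK.
have mK := measurable_half_planes P e.
have iK' : mu2.-integrable setT (EFin \o (f \_ (half_planes P e))).
  by rewrite -restrict_EFin; apply/integrable_restrict => //; rewrite setTI.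
rewrite -(iterated_integral n3 hP e1 convP df cf cg iK').
rewrite integral_mkcond restrict_EFin -integral12_prod_meas1//.
Qed.

(** Vertical slicing applied to the reflected polygon. Measurability and a bound are assumed because
    they carry over to the reflected integrand directly. *)
Lemma half_planes_integral_dx (P : 'I_n -> R * R) (e : R) (f g : R * R -> R) :
  (forall i, hplane (P i)) -> e = 1 \/ e = - 1 ->
  (forall i k, k != i -> k != ordS i ->
    0 < e * orient (P i) (P (ordS i)) (P k)) ->
  (forall x y, hplane (x, y) ->
    is_derive x 1 (fun x => g (x, y)) (f (x, y))) ->
  (forall X, hplane X -> {for X, continuous f}) ->
  (forall X, hplane X -> {for X, continuous g}) ->
  measurable_fun (half_planes P e) f ->
  (exists M, forall X, half_planes P e X -> `|f X| <= M) ->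
  (\int[mu2]_(X in half_planes P e) (f X)%:E)%E =
  (\sum_(i < n) e * ((P (ordS i)).2 - (P i).2) *
     edge_int g (P i) (P (ordS i)))%:E.
Proof.
move=> hP e1 convP df cf cg mf [M fM].
have mK := measurable_half_planes P e.
have iK : mu2.-integrable setT (EFin \o (f \_ (half_planes P e))).
  rewrite -restrict_EFin; apply/integrable_restrict => //; rewrite setTI.
  by apply: (half_planes_integrable hP e1 convP) => //; exists M.
pose P' i := swap_pair (P i).
have hP' i : hplane (P' i) by rewrite hplane_swap.
have e1' : - e = 1 \/ - e = - 1.
  by case: e1 => ->; [right|left; rewrite opprK].
have convP' i k : k != i -> k != ordS i ->
    0 < - e * orient (P' i) (P' (ordS i)) (P' k).
  by move=> ki kSi; rewrite orient_swap mulrNN; exact: convP.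
have cswap : continuous (@swap_pair R R).
  by move=> X; exact: (cvg_pair cvg_snd cvg_fst).
have cfs (h : R * R -> R) : (forall X, hplane X -> {for X, continuous h}) ->
    forall X, hplane X -> {for X, continuous (h \o @swap_pair R R)}.
  move=> ch X hX; apply: continuous_comp; first exact: cswap.
  by apply: ch; rewrite hplane_swap.
have df' x y : hplane (x, y) ->
    is_derive y 1 (fun y => (g \o @swap_pair R R) (x, y))
      ((f \o @swap_pair R R) (x, y)).
  by rewrite -hplane_swap => /df.
have swapK (X : R * R) : swap_pair (swap_pair X) = X by case: X.
have KE X : half_planes P' (- e) X = half_planes P e (swap_pair X).
  by rewrite -[in LHS](swapK X) half_planes_swap.
have iK' : mu2.-integrable setT
    (EFin \o ((f \o @swap_pair R R) \_ (half_planes P' (- e)))).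
  rewrite -restrict_EFin; apply/integrable_restrict => //; rewrite ?setTI.
    exact: measurable_half_planes.
  apply: (half_planes_integrable hP' e1' convP').
    apply: (measurable_comp mK) => //.
      by move=> _ [X KX <-]; rewrite -KE.
    apply: measurable_funTS.
    apply: measurable_fun_pair; first exact: measurable_snd.
    exact: measurable_fst.
  by exists M => X; rewrite KE => /fM.
have := iterated_integral n3 hP' e1' convP' df' (cfs _ cf) (cfs _ cg) iK'.
have -> : (\int[mu]_x \int[mu]_y
      (((f \o @swap_pair R R) \_ (half_planes P' (- e))) (x, y))%:E)%E =
    (\int[mu]_y \int[mu]_x ((f \_ (half_planes P e)) (x, y))%:E)%E.
  apply: eq_integral => x _; apply: eq_integral => y _; rewrite !patchE /=.
  suff -> : ((x, y) \in half_planes P' (- e)) =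
    ((y, x) \in half_planes P e) by [].
  by apply/idP/idP => /set_mem h; apply/mem_set; move: h; rewrite KE.
move=> H; rewrite integral_mkcond restrict_EFin -integral21_prod_meas1//.
rewrite /fubini_G /= H; congr EFin; apply: eq_bigr => i _.
rewrite opprK; congr (_ * _); apply: eq_Rintegral => t _ /=.
Qed.

End HalfPlanesIntegral.

(** * The weight as a divergence *)

Section Weight.
Variables (R : realType) (n : nat).
Implicit Types X A B : R * R.
Local Notation mu := (@lebesgue_measure R).
Local Notation mu2 := (mu \x mu)%E.
Hypothesis n3 : (3 <= n)%N.

Definition weight X : R := ((1 - dot X X) ^+ 2)^-1.

(** [weight] is the divergence of [X |-> potential X *: X], and its products
    with the coordinates are the partial derivatives of [potential]. *)
Definition potential X : R := (2 * (1 - dot X X))^-1.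

(** [flux fst a b] and [flux snd a c] are the two components of a vector field with divergence
    [(a + b * X.1 + c * X.2) * weight X]; the parameter [u] lets both share their estimates. *)
Let flux (u : R * R -> R) (a b : R) X := (a * u X + b) * potential X.
Let flux_derive (u : R * R -> R) (a b : R) X :=
  a * (potential X + u X ^+ 2 * weight X) + b * (u X * weight X).

Lemma measurable_one_sub_dot (D : set (R * R)) :
  measurable_fun D (fun X : R * R => 1 - dot X X).
Proof.
apply: measurable_funTS; apply: measurable_funB => //.
by apply: measurable_funD; apply: measurable_funM.
Qed.

Let continuous_dot : continuous (fun X : R * R => 1 - dot X X).
Proof.
move=> X; apply: cvgB; first exact: cvg_cst.
by apply: cvgD; apply: cvgM; solve [exact: cvg_fst | exact: cvg_snd].
Qed.

Let continuous_weight X : hplane X -> {for X, continuous weight}.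
Proof.
move=> /hplane_gt0 x0; apply: continuousV; first by rewrite expf_neq0// gt_eqF.
apply: (@continuous_comp _ _ _ (fun X => 1 - dot X X) (fun t => t ^+ 2)).
  exact: continuous_dot.
exact: exprn_continuous.
Qed.

Lemma continuous_potential X : hplane X -> {for X, continuous potential}.
Proof.
move=> /hplane_gt0 x0; apply: continuousV.
  by rewrite mulf_neq0 ?pnatr_eq0// gt_eqF.
by apply: cvgM; [exact: cvg_cst|exact: continuous_dot].
Qed.

Let continuous_flux u a b X : continuous u -> hplane X ->
  {for X, continuous (flux u a b)}.
Proof.
move=> cu hX; apply: cvgM; last exact: continuous_potential.
apply: cvgD; last exact: cvg_cst.
by apply: cvgM; [exact: cvg_cst|exact: cu].
Qed.

Let continuous_flux_derive u a b X : continuous u -> hplane X ->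
  {for X, continuous (flux_derive u a b)}.
Proof.
move=> cu hX; have cw := continuous_weight hX.
apply: cvgD; apply: cvgM; try exact: cvg_cst.
  apply: cvgD; first exact: continuous_potential.
  apply: cvgM => //.
  apply: (@continuous_comp _ _ _ u (fun t => t ^+ 2)); first exact: cu.
  exact: exprn_continuous.
by apply: cvgM => //; exact: cu.
Qed.

Let is_derive_dot (x y : R) : is_derive y 1 (fun y => x * x + y * y) (2 * y).
Proof.
have h := is_deriveD (is_derive_cst (x * x) y 1)
  (is_deriveM (is_derive_id y 1) (is_derive_id y 1)).
by apply: is_derive_eq h _; rewrite add0r /GRing.scale /= mulr1; ring.
Qed.

Let is_derive_flux (x y a b : R) : x * x + y * y < 1 ->
  is_derive y 1 (fun y => (a * y + b) * (2 * (1 - (x * x + y * y)))^-1)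
    (a * ((2 * (1 - (x * x + y * y)))^-1 +
      y ^+ 2 * ((1 - (x * x + y * y)) ^+ 2)^-1) +
     b * (y * ((1 - (x * x + y * y)) ^+ 2)^-1)).
Proof.
rewrite -subr_gt0 => q0.
have hq := is_deriveM (is_derive_cst (2 : R) y 1)
  (is_deriveB (is_derive_cst (1 : R) y 1) (is_derive_dot x y)).
have hl := is_deriveD (is_deriveM (is_derive_cst a y 1) (is_derive_id y 1))
  (is_derive_cst b y 1).
have q1 : 2 * (1 - (x * x + y * y)) != 0.
  by rewrite mulf_neq0 ?pnatr_eq0// gt_eqF.
have h := is_deriveM hl
  (@is_deriveV _ (fun y => 2 * (1 - (x * x + y * y))) _ _ _ q1 hq).
apply: is_derive_eq h _; rewrite /GRing.scale /= !fctE /cst /=.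
by field; rewrite gt_eqF.
Qed.

Section Oriented.
Variables (P : 'I_n -> R * R) (e : R).
Hypothesis hP : forall i, hplane (P i).
Hypothesis e1 : e = 1 \/ e = - 1.
Hypothesis convP : forall i k, k != i -> k != ordS i ->
  0 < e * orient (P i) (P (ordS i)) (P k).
Let K := half_planes P e.

Let KH : K `<=` (@hplane R) := half_planes_hplane n3 e1 convP hP.

Lemma measurable_weight : measurable_fun K weight.
Proof.
apply: measurable_funV_pos.
  by move=> X /KH/hplane_gt0 x0; rewrite exprn_gt0.
by apply: measurable_funX; exact: measurable_one_sub_dot.
Qed.

Let measurable_flux_derive u a b : measurable_fun setT u ->
  measurable_fun K (flux_derive u a b).
Proof.
move=> /(measurable_funTS (D := K)) mu'.
have mp : measurable_fun K potential.
  apply: measurable_funV_pos.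
    by move=> X /KH/hplane_gt0 x0; rewrite mulr_gt0.
  by apply: measurable_funM => //; exact: measurable_one_sub_dot.
apply: measurable_funD; apply: measurable_funM => //.
  apply: measurable_funD => //.
  by apply: measurable_funM; [exact: measurable_funX|exact: measurable_weight].
by apply: measurable_funM => //; exact: measurable_weight.
Qed.

Lemma weight_bounded : exists M, forall X, K X -> 0 <= weight X <= M.
Proof.
have [d d0 dK] := half_planes_lb n3 hP e1 convP.
exists (d ^+ 2)^-1 => X /[dup]/KH/hplane_gt0 x0 /dK dX.
rewrite /weight invr_ge0 exprn_ge0 ?(ltW x0)//= lef_pV2 ?posrE ?exprn_gt0//.
by rewrite lerXn2r// nnegrE ltW.
Qed.

Let flux_derive_bounded u a b : (forall X, hplane X -> `|u X| <= 1) ->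
  exists M, forall X, K X -> `|flux_derive u a b X| <= M.
Proof.
move=> u1; have [M wM] := weight_bounded.
exists (`|a| * (M + M) + `|b| * M) => X KX.
have /andP[w0 wX] := wM _ KX; have hX := KH KX; have uX := u1 _ hX.
have x0 := hplane_gt0 hX.
have px : `|potential X| <= M.
  have p0 : 0 < 2 * (1 - dot X X) by rewrite mulr_gt0.
  rewrite /potential ger0_norm ?(invr_ge0, ltW p0)//; apply: le_trans wX.
  rewrite /weight lef_pV2 ?posrE ?exprn_gt0//.
  have := dot_self_ge0 X; nra.
apply: (le_trans (ler_normD _ _)); rewrite !normrM; apply: lerD.
  apply: ler_wpM2l => //; apply: (le_trans (ler_normD _ _)); apply: lerD => //.
  rewrite normrM normrX (ger0_norm w0) -[leRHS]mul1r.
  by apply: ler_pM => //; rewrite ?exprn_ge0// exprn_ile1.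
apply: ler_wpM2l => //; rewrite (ger0_norm w0) -[leRHS]mul1r.
by apply: ler_pM.
Qed.

Let hplane_fst X : hplane X -> `|X.1| <= 1.
Proof.
move: X => [x y]; rewrite /hplane /dot /= => h.
by rewrite ler_norml; apply/andP; split; nra.
Qed.

Let hplane_snd X : hplane X -> `|X.2| <= 1.
Proof.
move: X => [x y]; rewrite /hplane /dot /= => h.
by rewrite ler_norml; apply/andP; split; nra.
Qed.

(** Along the side [x * (B.2 - A.2) - y * (B.1 - A.1)] is constant, so only the integral of
    [potential] remains. *)
Let edge_flux a b c A B : hplane A -> hplane B ->
  (B.2 - A.2) * edge_int (flux fst a b) A B -
  (B.1 - A.1) * edge_int (flux snd a c) A B =
  edge_int potential A B *
  (a * (A.1 * B.2 - A.2 * B.1) + b * (B.2 - A.2) - c * (B.1 - A.1)).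
Proof.
move=> hA hB.
have hAB t : 0 <= t <= 1 -> hplane (A + t *: (B - A)).
  exact: hplane_segment.
have cfst : continuous (fst : R * R -> R) by move=> X; exact: cvg_fst.
have csnd : continuous (snd : R * R -> R) by move=> X; exact: cvg_snd.
have c1 t t1 := @continuous_flux fst a b _ cfst (hAB t t1).
have c2 t t1 := @continuous_flux snd a c _ csnd (hAB t t1).
have i1 := edge_integrable c1; have i2 := edge_integrable c2.
have i0 := edge_integrable (fun t t1 => continuous_potential (hAB t t1)).
rewrite /edge_int -RintegralZl// -RintegralZl// -RintegralB//.
- rewrite -RintegralZr//; apply: eq_Rintegral => t _; rewrite /flux.
  rewrite /= /GRing.scale /=; set p := potential _; ring.
- apply: (edge_integrable (g := fun X => (B.2 - A.2) * flux fst a b X)) => t t1.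
  by apply: cvgM; [exact: cvg_cst|exact: c1].
- apply: (edge_integrable (g := fun X => (B.1 - A.1) * flux snd a c X)) => t t1.
  by apply: cvgM; [exact: cvg_cst|exact: c2].
Qed.

(** The coefficients of [a], [b], [c] in each summand form the cross product of [(1, P i)] and
    [(1, P (ordS i))], with its spatial part negated by the Lorentz form. *)
Lemma weight_integral (a b c : R) :
  (\int[mu2]_(X in K) ((a + b * X.1 + c * X.2) * weight X)%:E)%E =
  (\sum_(i < n) e * (edge_int potential (P i) (P (ordS i)) *
    (a * ((P i).1 * (P (ordS i)).2 - (P i).2 * (P (ordS i)).1) +
     b * ((P (ordS i)).2 - (P i).2) - c * ((P (ordS i)).1 - (P i).1))))%:E.
Proof.
have cfst : continuous (fst : R * R -> R) by move=> X; exact: cvg_fst.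
have csnd : continuous (snd : R * R -> R) by move=> X; exact: cvg_snd.
have mK := measurable_half_planes P e.
have m1 := measurable_flux_derive a b (@measurable_fst _ _ _ _).
have m2 := measurable_flux_derive a c (@measurable_snd _ _ _ _).
have b1 := flux_derive_bounded a b hplane_fst.
have b2 := flux_derive_bounded a c hplane_snd.
have i1 := half_planes_integrable n3 hP e1 convP m1 b1.
have i2 := half_planes_integrable n3 hP e1 convP m2 b2.
transitivity (\int[mu2]_(X in K) ((flux_derive fst a b X)%:E +
    (flux_derive snd a c X)%:E))%E.
  (* The coefficient of [a] is [2 * potential X + dot X X * weight X], which equals [weight X]. *)
  apply: eq_integral => X /set_mem/KH/hplane_gt0; rewrite -EFinD /flux_derive.
  rewrite /weight /potential; move: X => [x y]; rewrite /dot /= => q0.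
  congr EFin; field; rewrite gt_eqF//.
rewrite integralD//.
have -> : (\int[mu2]_(X in K) (flux_derive fst a b X)%:E)%E =
    (\sum_(i < n) e * ((P (ordS i)).2 - (P i).2) *
      edge_int (flux fst a b) (P i) (P (ordS i)))%:E.
  apply: half_planes_integral_dx => //.
  - move=> x y; rewrite /hplane /dot /= addrC => /(is_derive_flux a b).
    have -> : (fun x => flux fst a b (x, y)) =
        (fun x => (a * x + b) * (2 * (1 - (y * y + x * x)))^-1).
      by apply/funext => z; rewrite /flux /potential /dot /= (addrC (z * z)).
    by rewrite /flux_derive /potential /weight /dot /= (addrC (y * y)).
  - by move=> X; exact: continuous_flux_derive.
  - by move=> X; exact: continuous_flux.
have -> : (\int[mu2]_(X in K) (flux_derive snd a c X)%:E)%E =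
    (\sum_(i < n) - e * ((P (ordS i)).1 - (P i).1) *
      edge_int (flux snd a c) (P i) (P (ordS i)))%:E.
  apply: half_planes_integral_dy => //.
  - by move=> x y h; exact: is_derive_flux.
  - by move=> X; exact: continuous_flux_derive.
  - by move=> X; exact: continuous_flux.
rewrite -EFinD -big_split /=; congr EFin; apply: eq_bigr => i _.
by rewrite -edge_flux//; ring.
Qed.

End Oriented.
End Weight.

(** * The side integrals *)

Section EdgePotential.
Variable R : realType.
Implicit Types X A B : R * R.

Lemma sqrt_klein_gram_lt A B : hplane A -> hplane B ->
  Num.sqrt (klein_gram A B) < 1 - dot A B.
Proof.
move=> hA hB.
have ab0 : 0 < 1 - dot A B by apply: hplane_dot_gt0 => //; exact: ltW.
rewrite -(@ltr_pXn2r _ 2)// ?nnegrE ?sqrtr_ge0 ?(ltW ab0)//.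
rewrite sqr_sqrtr ?klein_gram_ge0// /klein_gram gtrBl.
by rewrite mulr_gt0 ?hplane_gt0.
Qed.

(** The product of [1 - dot A B + s] and [1 - dot A B - s] is [(1 - dot A A) * (1 - dot B B)], so
    their quotient is the exponential of twice the distance. *)
Lemma dist_ln A B : hplane A -> hplane B ->
  let s := Num.sqrt (klein_gram A B) in
  dist A B = (ln (1 - dot A B + s) - ln (1 - dot A B - s)) / 2.
Proof.
move=> hA hB s.
have a0 := hplane_gt0 hA; have b0 := hplane_gt0 hB.
have la0 := hplane_sqrt_gt0 hA; have lb0 := hplane_sqrt_gt0 hB.
have ab0 : 0 < 1 - dot A B by apply: hplane_dot_gt0 => //; exact: ltW.
have s0 : 0 <= s by exact: sqrtr_ge0.
have s2 : s ^+ 2 = klein_gram A B by rewrite sqr_sqrtr// klein_gram_ge0.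
have sN : 0 < 1 - dot A B - s by rewrite subr_gt0 sqrt_klein_gram_lt.
have sP : 0 < 1 - dot A B + s by rewrite ltr_wpDr.
set la := Num.sqrt (1 - dot A A) in la0.
set lb := Num.sqrt (1 - dot B B) in lb0.
have c0 : 0 < la * lb by rewrite mulr_gt0.
rewrite /dist -[_ / _]/(dist_ratio A B) /arcosh dist_ratio_sqr//.
rewrite addrAC subrr add0r.
rewrite sqrtrM ?klein_gram_ge0// sqrtrV ?mulr_ge0 ?(ltW a0) ?(ltW b0)//.
rewrite sqrtrM ?(ltW a0)// -/s -/la -/lb /dist_ratio -/la -/lb -mulrDl.
rewrite lnM ?posrE ?invr_gt0// lnV ?posrE//.
have : ln ((la * lb) ^+ 2) = ln (1 - dot A B + s) + ln (1 - dot A B - s).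
  rewrite -lnM ?posrE// (mulrC (_ + s)) -subr_sqr s2 /klein_gram exprMn.
  rewrite !sqr_sqrtr ?ltW//.
  by congr ln; ring.
by rewrite lnXn// -mulr_natr; lra.
Qed.

(** Along the side [1 - dot X X] is quadratic in [t], and [al] times it factors into the affine
    functions [N] and [M]. Partial fractions give the primitive [F]; [N] and [M] agree at 0, and at
    1 they are the two arguments of [ln] in [dist_ln]. *)
Lemma edge_int_potential A B : hplane A -> hplane B -> A != B ->
  edge_int (@potential R) A B = dist A B / (2 * Num.sqrt (klein_gram A B)).
Proof.
move=> hA hB AB; set s := Num.sqrt _.
have a0 := hplane_gt0 hA; have b0 := hplane_gt0 hB.
have ab0 : 0 < 1 - dot A B by apply: hplane_dot_gt0 => //; exact: ltW.
have s0 : 0 < s by rewrite sqrtr_gt0 klein_gram_gt0.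
have s2 : s ^+ 2 = klein_gram A B by rewrite sqr_sqrtr// klein_gram_ge0.
have sN : 0 < 1 - dot A B - s by rewrite subr_gt0 sqrt_klein_gram_lt.
have sP : 0 < 1 - dot A B + s by rewrite addr_gt0.
pose al := 1 - dot A A; pose be := 1 - dot A B.
pose N (t : R) : R := al + t * (be + s - al).
pose M (t : R) : R := al + t * (be - s - al).
have affine_gt0 (c t : R) : 0 < c -> 0 <= t <= 1 -> 0 < al + t * (c - al).
  move=> c0 /andP[t0 t1].
  have -> : al + t * (c - al) = (1 - t) * al + t * c by ring.
  have [->|tN0] := eqVneq t 0; first by rewrite subr0 mul1r mul0r addr0.
  have t_gt0 : 0 < t by rewrite lt_def tN0.
  by apply: ltr_wpDl; [rewrite mulr_ge0 ?subr_ge0// ltW|rewrite mulr_gt0].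
pose F (t : R) : R := (4 * s)^-1 * (ln (N t) - ln (M t)).
have dF (t : R) : 0 <= t <= 1 -> is_derive t 1 F (potential (A + t *: (B - A))).
  move=> t01; have Nt : 0 < N t by exact: affine_gt0.
  have Mt : 0 < M t by exact: affine_gt0.
  have dN := @is_derive1_comp _ (@ln R) N t _ _
    (is_derive1_ln Nt) (is_derive_affine al _ t).
  have dM := @is_derive1_comp _ (@ln R) M t _ _
    (is_derive1_ln Mt) (is_derive_affine al _ t).
  have h := is_deriveM (is_derive_cst (4 * s)^-1 t 1) (is_deriveB dN dM).
  apply: is_derive_eq h _; rewrite /GRing.scale /= !fctE /cst /= mulr0 addr0.
  have q0 := hplane_gt0 (hplane_segment hA hB t01).
  have NM : N t * M t = al * (1 - dot (A + t *: (B - A)) (A + t *: (B - A))).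
    have -> : N t * M t = (al + t * (be - al)) ^+ 2 - t ^+ 2 * s ^+ 2.
      by rewrite /N /M; ring.
    rewrite s2 /klein_gram /al /be.
    move: (A) (B) => [x1 x2] [y1 y2].
    by rewrite /dot /= /GRing.scale /=; ring.
  rewrite /potential; set q := 1 - dot (A + _) _ in q0 NM *.
  have -> : q = N t * M t / al by rewrite NM mulrAC mulfV ?mul1r// gt_eqF.
  move: Nt Mt (lt0r_neq0 Nt) (lt0r_neq0 Mt) => _ _ Nt Mt.
  have MN : (be + s - al) * M t - (be - s - al) * N t = 2 * s * al.
    by rewrite /N /M; ring.
  have s1 : s != 0 by rewrite gt_eqF.
  have al1 : al != 0 by rewrite gt_eqF.
  have -> : (4 * s)^-1 * ((N t)^-1 * (be + s - al) - (M t)^-1 * (be - s - al)) =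
    (4 * s)^-1 * ((be + s - al) * M t - (be - s - al) * N t) / (N t * M t).
    by field; rewrite s1 Nt Mt.
  by rewrite MN; field; rewrite s1 Nt Mt al1.
have cp (t : R) : 0 <= t <= 1 ->
    {for t, continuous (fun t : R => potential (A + t *: (B - A)))}.
  move=> t01; apply: edge_continuous.
  exact/continuous_potential/hplane_segment.
rewrite /edge_int /Rintegral (integral_derive ler01 dF cp) /= /F /N /M.
rewrite !mul0r !addr0 !mul1r ![al + _]addrC !subrK subrr mulr0 subr0.
rewrite dist_ln// -/s -/be; field; exact: lt0r_neq0.
Qed.

End EdgePotential.

(** * The center of mass and the mass of a regular polygon *)

Section RegularPolygon.
Variables (R : realType) (n : nat).
Implicit Types X A B : R * R.
Local Notation mu := (@lebesgue_measure R).
Local Notation mu2 := (mu \x mu)%E.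
Hypothesis n3 : (3 <= n)%N.
Variables (P : 'I_n -> R * R) (e : R).
Hypothesis hP : forall i, hplane (P i).
Hypothesis e1 : e = 1 \/ e = - 1.
Hypothesis convP : forall i k, k != i -> k != ordS i ->
  0 < e * orient (P i) (P (ordS i)) (P k).
Variable O : R * R.
Hypothesis hO : hplane O.
Hypothesis distO : forall i j, dist O (P i) = dist O (P j).
Hypothesis sideP : forall i j, side_length P i = side_length P j.
Let K := half_planes P e.
Let KH : K `<=` (@hplane R) := half_planes_hplane n3 e1 convP hP.

Lemma sum_ordS_diff (h : 'I_n -> R) : \sum_i (h (ordS i) - h i) = 0.
Proof. by rewrite sumrB [X in _ - X](reindex_inj (@ordS_inj n)) /= subrr. Qed.

(** The Lorentz vectors above the vertices are [c *: o + q i] with [o] above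
    [O] and [q i] orthogonal to [o].  In the sum of their cyclic cross products
    the terms [o x (q (ordS i) - q i)] telescope, and [q i x q (ordS i)] is
    parallel to [o]: the Klein barycenter of the polygon is [O]. *)
Lemma weight_moments : exists W : R, forall a b c : R,
  (\int[mu2]_(X in K) ((a + b * X.1 + c * X.2) * weight X)%:E)%E =
  (W * (a + b * O.1 + c * O.2))%:E.
Proof.
have i0 : 'I_n by case: n n3 => // m _; exact: ord0.
pose k i := edge_int (@potential R) (P i) (P (ordS i)).
pose l i := Num.sqrt (1 - dot (P i) (P i)).
pose nu0 i := (P i).1 * (P (ordS i)).2 - (P i).2 * (P (ordS i)).1.
pose m := dist_ratio O (P i0) * Num.sqrt (1 - dot O O).
have lO := hplane_sqrt_gt0 hO.
have l0 i : l i != 0 := lt0r_neq0 (hplane_sqrt_gt0 (hP i)).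
have m0 : m != 0 by rewrite mulf_neq0 ?gt_eqF// dist_ratio_gt0.
have pE i : 1 - dot O (P i) = m * l i.
  rewrite /m -cosh_dist// (distO i0 i) cosh_dist// /dist_ratio -/(l i).
  by field; rewrite l0 gt_eqF.
pose d := side_length P i0; pose kappa := d / (2 * sinh d).
(* Equal sides make [kappa] common; the remaining factors normalise the Lorentz vectors above the
   two vertices. *)
have kE i : k i = kappa / (l i * l (ordS i)).
  have ne := convex_vertex_neq n3 convP i.
  rewrite /k edge_int_potential//.
  have -> : dist (P i) (P (ordS i)) = d by exact: sideP.
  have sE : Num.sqrt (klein_gram (P i) (P (ordS i))) =
      sinh d * (l i * l (ordS i)).
    rewrite /d -(sideP i) /side_length sinh_dist// -/(l _) -/(l _) divfK//.
    by rewrite mulf_neq0.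
  have s0 : sinh d != 0.
    apply: contraTneq (klein_gram_gt0 (hP i) ne) => d0.
    by rewrite -leNgt -sqrtr_eq0 sE d0 mul0r.
  by rewrite sE /kappa; field; rewrite s0 !l0.
exists (\sum_(i < n) e * (k i * nu0 i)) => a b c.
rewrite (weight_integral n3 hP e1 convP); congr EFin.
(* The telescoping terms: [e * kappa * m] times the spatial part of the unit Lorentz vector above
   [P i], turned by a right angle. *)
pose h1 i := e * kappa * m * ((P i).2 / l i).
pose h2 i := - (e * kappa * m * ((P i).1 / l i)).
have hE1 i : e * (k i * ((P (ordS i)).2 - (P i).2)) =
    O.1 * (e * (k i * nu0 i)) + (h1 (ordS i) - h1 i).
  have p1 := pE i; have p2 := pE (ordS i).
  rewrite /h1 kE /nu0.
  (* Equal circumradii make [l] an affine function of the vertex, which leaves a rational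
     identity. *)
  have -> : l i = (1 - dot O (P i)) / m by rewrite p1 mulrAC mulfV ?mul1r.
  have -> : l (ordS i) = (1 - dot O (P (ordS i))) / m.
    by rewrite p2 mulrAC mulfV ?mul1r.
  have q1 : 1 - dot O (P i) != 0 by rewrite p1 mulf_neq0.
  have q2 : 1 - dot O (P (ordS i)) != 0 by rewrite p2 mulf_neq0.
  move: q1 q2; rewrite /dot => q1 q2.
  by field; rewrite m0 q1 q2.
have hE2 i : e * (k i * - ((P (ordS i)).1 - (P i).1)) =
    O.2 * (e * (k i * nu0 i)) + (h2 (ordS i) - h2 i).
  have p1 := pE i; have p2 := pE (ordS i).
  rewrite /h2 kE /nu0.
  have -> : l i = (1 - dot O (P i)) / m by rewrite p1 mulrAC mulfV ?mul1r.
  have -> : l (ordS i) = (1 - dot O (P (ordS i))) / m.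
    by rewrite p2 mulrAC mulfV ?mul1r.
  have q1 : 1 - dot O (P i) != 0 by rewrite p1 mulf_neq0.
  have q2 : 1 - dot O (P (ordS i)) != 0 by rewrite p2 mulf_neq0.
  move: q1 q2; rewrite /dot => q1 q2.
  by field; rewrite m0 q1 q2.
transitivity (\sum_(i < n) ((e * (k i * nu0 i)) * (a + b * O.1 + c * O.2) +
    (b * (h1 (ordS i) - h1 i) + c * (h2 (ordS i) - h2 i)))).
  apply: eq_bigr => i _; rewrite -/(k i) -/(nu0 i).
  transitivity (a * (e * (k i * nu0 i)) +
    b * (e * (k i * ((P (ordS i)).2 - (P i).2))) +
    c * (e * (k i * - ((P (ordS i)).1 - (P i).1)))); first by ring.
  by rewrite hE1 hE2; ring.
rewrite big_split /= -mulr_suml big_split /= -[X in _ + (X + _)]mulr_sumr.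
by rewrite -[X in _ + (_ + X)]mulr_sumr !sum_ordS_diff !mulr0 !addr0.
Qed.

Lemma orientE A B X : orient A B X = A.1 * B.2 - A.2 * B.1
  + - (B.2 - A.2) * X.1 + (B.1 - A.1) * X.2.
Proof. by rewrite /orient; ring. Qed.

Variable L : lamina R.
Hypothesis regionL : region L = K.
Hypothesis densityL : forall X, region L X -> density L X = 1.

Variable W : R.
Hypothesis WE : forall a b c : R,
  (\int[mu2]_(X in K) ((a + b * X.1 + c * X.2) * weight X)%:E)%E =
  (W * (a + b * O.1 + c * O.2))%:E.

(** The area density is [weight X * Num.sqrt (1 - dot X X)]; the moments and the mass both have
    integrands that become affine after multiplication by this root. *)
Let hintegral_affine (f : R * R -> R) (s a b c : R) :
  (forall X, K X ->
    f X * Num.sqrt (1 - dot X X) = s * (a + b * X.1 + c * X.2)) ->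
  hintegral (region L) f = (W * (s * (a + b * O.1 + c * O.2)))%:E.
Proof.
move=> fE.
have -> : s * (a + b * O.1 + c * O.2) = s * a + (s * b) * O.1 + (s * c) * O.2.
  by ring.
rewrite -WE /hintegral regionL; apply: eq_integral => X /set_mem KX.
have hX := KH KX; have x0 := hplane_sqrt_gt0 hX; have X2 := hplane_gt0 hX.
rewrite area_densityE//; congr EFin; rewrite /weight.
have -> : 1 - dot X X = Num.sqrt (1 - dot X X) ^+ 2 by rewrite sqr_sqrtr// ltW.
rewrite [in LHS]sqr_sqrtr ?(ltW X2)//.
have := fE X KX; set t := Num.sqrt _ in x0 * => ft.
have -> : s * a + s * b * X.1 + s * c * X.2 = f X * t by rewrite ft; ring.
by field; rewrite gt_eqF.
Qed.

(** [W] is the integral of [weight], which dominates the area density because [1 - dot X X <= 1];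
    the positive area of the lamina is thus a lower bound. *)
Lemma total_weight_gt0 : 0 < W.
Proof.
have := WE 1 0 0; rewrite !mul0r !addr0 mulr1 => W1.
have := region_area_gt0 L; rewrite /area /hintegral regionL.
rewrite -lte_fin -W1 => /lt_le_trans; apply.
have mK : measurable K by exact: measurable_half_planes.
have mw : measurable_fun K (@weight R) := measurable_weight n3 hP e1 convP.
have [M wM] := weight_bounded n3 hP e1 convP.
have ad X : K X -> 0 <= cst 1 X * area_density X <=
    (1 + 0 * X.1 + 0 * X.2) * weight X.
  move=> KX; have hX := KH KX; have x0 := hplane_sqrt_gt0 hX.
  have X2 := hplane_gt0 hX.
  rewrite area_densityE// /cst !mul0r !addr0 !mul1r invr_ge0.
  rewrite exprn_ge0 ?(ltW x0)//=.
  have -> : weight X = (Num.sqrt (1 - dot X X) ^+ 4)^-1.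
    by rewrite -[4%N]/((2 * 2)%N) exprM sqr_sqrtr// ltW.
  have t1 : Num.sqrt (1 - dot X X) <= 1.
    by rewrite -[leRHS]sqrtr1 ler_wsqrtr// gerBl dot_self_ge0.
  rewrite lef_pV2 ?posrE ?exprn_gt0//.
  by rewrite exprS ler_piMl// exprn_ge0// ltW.
apply: ge0_le_integral => //.
- by move=> X /ad/andP[? _]; rewrite lee_fin.
- apply/measurable_EFinP; apply: measurable_funM => //.
  have ms : measurable_fun K (fun X : R * R => Num.sqrt (1 - dot X X)).
    apply: (eq_measurable_fun (fun X : R * R => powR (1 - dot X X) 2^-1)).
      by move=> X /set_mem/KH/hplane_gt0/ltW x0; rewrite powR12_sqrt.
    apply: measurableT_comp (measurable_powR _) _.
    exact: measurable_one_sub_dot.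
  apply: (eq_measurable_fun
    (fun X : R * R => (Num.sqrt (1 - dot X X) ^+ 3)^-1)).
    by move=> X /set_mem/KH hX; rewrite area_densityE.
  apply: measurable_funV_pos; last exact: measurable_funX.
  by move=> X /KH hX; rewrite exprn_gt0// hplane_sqrt_gt0.
- apply/measurable_EFinP; apply: measurable_funM => //.
  by apply: measurable_funD; [apply: measurable_funD => //|];
    apply: measurable_funM => //; exact: measurable_funTS.
- by move=> X /ad/andP[_ ?]; rewrite lee_fin.
Qed.

(** The side sign cancels the absolute value in the distance to the line, so the moment is a
    positive multiple of [orient] at [O]. *)
Lemma balancedP (m : dline R) :
  balanced L m <-> orient (dl_src m) (dl_tgt m) O = 0.
Proof.
set A := dl_src m; set B := dl_tgt m.
have D0 : 0 < Num.sqrt (klein_gram A B).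
  by rewrite sqrtr_gt0 klein_gram_gt0//; [exact: dl_src_in|exact: dl_neq].
rewrite /balanced /moment.
rewrite (@hintegral_affine _ (Num.sqrt (klein_gram A B))^-1
  (A.1 * B.2 - A.2 * B.1) (- (B.2 - A.2)) (B.1 - A.1)); last first.
  move=> X KX; have hX := KH KX; have x0 := hplane_sqrt_gt0 hX.
  rewrite densityL ?regionL// mulr1 sinh_dist_to_line// -/A -/B -orientE.
  rewrite /side_sign -/A -/B mulrA -numEsg.
  by field; rewrite !gt_eqF.
rewrite -orientE; split=> [[]/eqP|->]; last by rewrite !mulr0.
rewrite !mulf_eq0 invr_eq0 (gt_eqF D0) (gt_eqF total_weight_gt0)/=.
by move/eqP.
Qed.

Lemma center_of_massE : center_of_mass L = O.
Proof.
apply: get_unique; first by split=> // m /balancedP mO; split.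
move=> C [hC balC].
(* A shift of a coordinate by [t] adds at most [2 * t + t ^+ 2 <= 3 * t] to the squared norm, and
   [1 - dot O O = 4 * t]. The horizontal and the vertical line through [O] then determine [C]. *)
pose t := (1 - dot O O) / 4.
have t0 : 0 < t by rewrite divr_gt0// hplane_gt0.
have [tO1 tO2] : hplane (O.1 + t, O.2) /\ hplane (O.1, O.2 + t).
  move: (hO) t0; rewrite /t /hplane /dot /=; move: (O) => [x y] /=.
  set u := _ / 4 => h u0.
  have tE : x * x + y * y = 1 - 4 * u by rewrite /u; field.
  have x1 : x <= 1 by nra.
  have y1 : y <= 1 by nra.
  have u1 : u <= 1 by nra.
  split; rewrite -subr_gt0.
    have -> : 1 - ((x + u) * (x + u) + y * y) =
      1 - (x * x + y * y) - 2 * x * u - u ^+ 2 by ring.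
    by rewrite tE; nra.
  have -> : 1 - (x * x + (y + u) * (y + u)) =
    1 - (x * x + y * y) - 2 * y * u - u ^+ 2 by ring.
  by rewrite tE; nra.
have ne1 : O != (O.1 + t, O.2).
  apply/eqP => /(congr1 fst) /= /eqP; rewrite -subr_eq0 opprD addrA subrr sub0r.
  by rewrite oppr_eq0 gt_eqF.
have ne2 : O != (O.1, O.2 + t).
  apply/eqP => /(congr1 snd) /= /eqP; rewrite -subr_eq0 opprD addrA subrr sub0r.
  by rewrite oppr_eq0 gt_eqF.
have bal m : dl_src m = O -> balanced L m.
  by move=> mO; apply/balancedP; rewrite mO orient_self.
have [_ o1] := balC (DLine hO tO1 ne1) (bal (DLine hO tO1 ne1) erefl).
have [_ o2] := balC (DLine hO tO2 ne2) (bal (DLine hO tO2 ne2) erefl).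
have {}o1 : t * (C.2 - O.2) = 0 by rewrite -o1 /orient /=; ring.
have {}o2 : t * (O.1 - C.1) = 0 by rewrite -o2 /orient /=; ring.
move: o1 o2 => /eqP + /eqP; rewrite !(mulf_eq0 t) gt_eqF//= !subr_eq0.
by move=> /eqP C2 /eqP C1; apply/pair_eqP/andP; rewrite C1 C2.
Qed.

(** [O] is the mean of the region for the positive weight [weight], so every affine function
    nonnegative on the region is nonnegative at [O]. *)
Lemma orient_center_ge0 i : 0 <= e * orient (P i) (P (ordS i)) O.
Proof.
set A := P i; set B := P (ordS i).
have := WE (e * (A.1 * B.2 - A.2 * B.1)) (e * - (B.2 - A.2)) (e * (B.1 - A.1)).
rewrite -!mulrA -!mulrDr -orientE => h.
rewrite -(pmulr_rge0 _ total_weight_gt0) -lee_fin -h.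
apply: integral_ge0 => X KX; rewrite lee_fin; apply: mulr_ge0.
  have := KX i; rewrite -/A -/B orientE; congr (0 <= _); ring.
by rewrite /weight invr_ge0 exprn_ge0// ltW// hplane_gt0//; exact: KH.
Qed.

(** [WE] is read backwards at the affine function [1 - dot X O]: in [weight_integral] the
    coefficient of a side then becomes [orient (P i) (P (ordS i)) O], the numerator of [sinh r]. *)
Lemma mass_regular (r : R) : (forall i, dist_to O (side P i) = r) ->
  mass L = (2^-1 * perimeter P * sinh r)%:E.
Proof.
move=> rE; rewrite /mass center_of_massE.
have lO := hplane_sqrt_gt0 hO.
rewrite (@hintegral_affine _
  (Num.sqrt (1 - dot O O))^-1 1 (- O.1) (- O.2)); last first.
  move=> X KX; have hX := KH KX; have x0 := hplane_sqrt_gt0 hX.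
  rewrite densityL ?regionL// mul1r cosh_dist// /dist_ratio.
  have -> : 1 - dot X O = 1 + - O.1 * X.1 + - O.2 * X.2 by rewrite /dot; ring.
  by field; rewrite !gt_eqF.
have -> : W * ((Num.sqrt (1 - dot O O))^-1 * (1 + - O.1 * O.1 + - O.2 * O.2)) =
  (Num.sqrt (1 - dot O O))^-1 * (W * (1 + - O.1 * O.1 + - O.2 * O.2)) by ring.
rewrite EFinM -WE (weight_integral n3 hP e1 convP) -EFinM; congr EFin.
rewrite /perimeter mulr_sumr [in RHS]mulr_sumr mulr_suml; apply: eq_bigr => i _.
have ne := convex_vertex_neq n3 convP i.
have D0 : 0 < Num.sqrt (klein_gram (P i) (P (ordS i))).
  by rewrite sqrtr_gt0 klein_gram_gt0.
rewrite -(rE i) sinh_dist_to_isosceles// edge_int_potential//.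
rewrite -/(side_length P i).
have -> : `|orient (P i) (P (ordS i)) O| = e * orient (P i) (P (ordS i)) O.
  have := orient_center_ge0 i; case: e1 => ->.
    by rewrite mul1r => /ger0_norm.
  by rewrite mulN1r oppr_ge0 => /ler0_norm.
rewrite orientE; field; rewrite !gt_eqF//.
Qed.

End RegularPolygon.

Theorem proposition6p6 (R : realType) (n : nat) (hn : (3 <= n)%N)
  (P : 'I_n -> R * R) (hP : regular_polygon P)
  (r : R) (hr : polygon_inradius P r)
  (L : lamina R) (hregion : region L = polygon_region P)
  (hdensity : forall X, region L X -> density L X = 1) :
  mass L = (2^-1 * perimeter P * sinh r)%:E /\
  forall a : R, (forall i, side_length P i = a) ->
    mass L = (2^-1 * n%:R * a * sinh r)%:E.
Proof.
have [convP sideP _] := hP; have [hplP _] := convP.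
have [e e1 convP'] := convex_polygon_oriented hn convP.
have [Z [hZ distZ] rZ] := hr.
rewrite (polygon_region_half_planes hn hplP e1 convP') in hregion.
have [W WE] := weight_moments hn hplP e1 convP' hZ distZ sideP.
have massE := mass_regular hn hplP e1 convP' hZ distZ hregion hdensity WE rZ.
split=> // a aP; rewrite massE; congr EFin.
rewrite /perimeter (eq_bigr (fun=> a))// sumr_const card_ord -mulr_natl.
by ring.
Qed.
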